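(* Let $m>0$ and $p>1$ satisfy $\gamma := m(p-1)-1\ge 0$. Let $f\in C^1[0,1]$ with $f(0)=f(1)=0$, $f(u)>0$ for $u\in(0,1)$, and $f$ concave on $[0,1]$. Then the minimal travelling wave speed $c_*(m,p)$ of $\partial_t u=\partial_x\left(|\partial_x u^m|^{p-2}\partial_x u^m\right)+f(u)$ satisfies $$c_*(m,p)\le p\left(\frac{m}{p-1}\right)^{(p-1)/p}\sup_{u\in(0,1)}\left[u^{\gamma}\left(\frac{f(u)}{u}\right)^{p-1}\right]^{1/p}.$$
   Context: Travelling waves and $c_*$: a travelling wave of speed $c>0$ joining the equilibria $0$ and $1$ is a (weak) solution $u(\xi)$, $\xi=x+ct$, of the equation, with values in $[0,1]$, monotone increasing (with $u_\xi>0$ where $0<u<1$), $u\to0$ as $\xi\to-\infty$ and $u\to1$ as $\xi\to+\infty$; it satisfies $$c\,u_\xi=m^{p-1}\frac{d}{d\xi}\left(u^{(m-1)(p-1)}(u_\xi)^{p-1}\right)+f(u)$$ where $0<u<1$. The wave may be finite, i.e. vanish identically on a left half-line, with continuous flux. In terms of the phase-space coordinate $q(u)=u^{m-1}u_\xi$, regarded as a function of $u\in(0,1)$, the equation reads $$\frac{c}{m^{p-1}}=\frac{d}{du}\left(q(u)^{p-1}\right)+\frac{F(u)}{q(u)},$$ with $q>0$ on $(0,1)$, $q(0)=q(1)=0$, where $F(u)=u^{m-1}f(u)/m^{p-1}$. For $\gamma\ge0$ it is known that there is a number $c_*(m,p)>0$ such that a travelling wave joining $0$ and $1$, unique up to translation,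 exists for every $c\ge c_*(m,p)$ and none exists for $0<c<c_*(m,p)$. This number is the minimal speed $c_*(m,p)$ (it depends on $f$ as well). *)

(* Defs.v *)
From Stdlib Require Import Reals.
From Coquelicot Require Import Coquelicot.
Open Scope R_scope.

(* [Rpower 0 a] is a junk value ([Rpower 0 a = 1]); here [0^a = 0].  This is
   the right value for [u^m] with [m > 0] at a point where [u] vanishes; in
   [flux] below the factor at [0] is multiplied by [0] anyway. *)
Definition rpow (x a : R) : R :=
  if Rlt_dec 0 x then Rpower x a else 0.

Definition unit_interval (x : R) : Prop := 0 <= x <= 1.

(* [f] is used on [0,1] only, so derivatives and limits are relative to [0,1]
   (one-sided at the endpoints). *)
Definition C1_unit (f : R -> R) : Prop :=
  exists df : R -> R,
    forall x, unit_interval x ->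
      D_in f df unit_interval x /\ continue_in df unit_interval x.

Definition concave_unit (f : R -> R) : Prop :=
  forall x y t, unit_interval x -> unit_interval y -> unit_interval t ->
    t * f x + (1 - t) * f y <= f (t * x + (1 - t) * y).

(* |(u^m)'|^(p-2) (u^m)' *)
Definition flux (m p : R) (u : R -> R) (x : R) : R :=
  let v := Derive (fun y => rpow (u y) m) x in
  rpow (Rabs v) (p - 2) * v.

Definition test_function (phi : R -> R) (a b : R) : Prop :=
  a < b /\
  (forall n x, ex_derive_n phi n x) /\
  (forall x, x <= a \/ b <= x -> phi x = 0).

(* The profile [u] of a wave [u(x + c t)] of
     u_t = (|(u^m)_x|^(p-2) (u^m)_x)_x + f(u)
   joining 0 and 1.  Differentiability of u^m makes its [Derive] meaningful;
   with continuity of the flux on the whole line (in particular at the free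
   boundary of a finite wave) u^m is C^1, so [u] and both integrands of
   [tw_weak] are continuous.  [tw_weak] states  c u' = flux' + f(u)  in the
   sense of distributions. *)
Record travelling_wave (m p : R) (f : R -> R) (c : R) (u : R -> R) : Prop := {
  tw_range : forall x, 0 <= u x <= 1;
  tw_increasing : forall x y, x <= y -> u x <= u y;
  tw_lim_minus : is_lim u m_infty 0;
  tw_lim_plus : is_lim u p_infty 1;
  tw_flux_def : forall x, ex_derive (fun y => rpow (u y) m) x;
  tw_flux_continuous : forall x, continuous (flux m p u) x;
  tw_weak : forall phi a b, test_function phi a b ->
    RInt (fun x => (flux m p u x - c * u x) * Derive phi x) a b
      = RInt (fun x => f (u x) * phi x) a b;
  tw_slope : forall x, 0 < u x < 1 -> ex_derive u x /\ 0 < Derive u x;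
  tw_ode : forall x, 0 < u x < 1 ->
    let w := fun y =>
      Rpower (u y) ((m - 1) * (p - 1)) * Rpower (Derive u y) (p - 1) in
    ex_derive w x /\
    c * Derive u x = Rpower m (p - 1) * Derive w x + f (u x)
}.

Definition is_minimal_speed (m p : R) (f : R -> R) (cstar : R) : Prop :=
  0 < cstar /\
  (forall c, cstar <= c -> exists u, travelling_wave m p f c u) /\
  (forall c, 0 < c < cstar -> ~ exists u, travelling_wave m p f c u).

(* Main.v *)
Require Import Defs.
From Stdlib Require Import Reals Lra Lia.
From Stdlib Require Import IndefiniteDescription.
From Coquelicot Require Import Coquelicot.
Open Scope R_scope.

(** The minimal speed is at most every speed at which a wave exists, so it suffices
    to construct a wave whose speed [c] is the right-hand side of the inequality.

    Along a wave let [Q = (u^m)'], viewed as a function of the value [u] in [0,1],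
    let [P = Q^(p-1)] be the flux and [K(u) = m u^(m-1) f(u)].  The wave equation
    becomes [dP/du = c - K / Q] with [P = 0] at both ends.  Write [c = p lam].  By
    the choice of [lam] and the definition of the supremum,
    [K <= (c - lam) (lam u)^(1/(p-1))] ([reaction_le_of_sup]), which says exactly
    that the line [lam u] satisfies [dP/du <= c - K / Q].  The value [c / p] for
    the slope is the one that makes this requirement on [K] weakest.

    In the variable [E = Q^p] the equation reads
    [dE/du = p/(p-1) (c E^(1/p) - K)]: it is no longer singular at [E = 0], and its
    right-hand side is nondecreasing in [E].  Solved backwards from [E(1) = 0] it is
    therefore dissipative, and has a solution although [E^(1/p)] is not Lipschitz
    ([power_ode]).  That solution is positive, because at an interior zero it would
    have a minimum while its derivative would not vanish; and it stays
    below the image of the line [lam u], by comparison.  Hence it is pressed down to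
    [0] at [u = 0] ([phase_plane_solution]): this is the point where the size
    of [c] matters, as for a smaller speed the backward orbit could miss the origin.

    The profile is recovered by inverting [x = int dv / u'(v)] ([heteroclinic]).
    The orbit may reach [0] (or [1]) in finite time.  There [u^m] and the flux minus
    [c u] remain differentiable, since their derivatives [Q] and [- f], which are
    known in the interior, tend to [0] at the equilibria
    ([derive_across_free_boundary]).  The weak form is then integration by parts. *)

(** * Mean values and comparison *)

Lemma continuous_epsP (f : R -> R) (x : R) :
  continuous f x <->
  forall eps, 0 < eps -> exists del, 0 < del /\
    forall y, Rabs (y - x) < del -> Rabs (f y - f x) < eps.
Proof.
  split.
  - intros H eps He.
    destruct (proj1 (filterlim_locally f (f x)) H (mkposreal eps He)) as [d Hd].
    exists d; split; [apply cond_pos|]. intros y Hy. apply (Hd y Hy).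
  - intros H. apply filterlim_locally. intros eps.
    destruct (H eps (cond_pos eps)) as [d [Hd0 Hd]].
    exists (mkposreal d Hd0). intros y Hy. apply (Hd y Hy).
Qed.

Lemma is_derive_continuous (f : R -> R) (x l : R) :
  is_derive f x l -> continuous f x.
Proof.
  intros H. apply (ex_derive_continuous (K := R_AbsRing) (V := R_NormedModule)).
  now exists l.
Qed.

Lemma continuous_continuity_pt (f : R -> R) (x : R) :
  continuous f x -> continuity_pt f x.
Proof. intros H. now apply continuity_pt_filterlim. Qed.

(** Derivatives are needed only in the open interval here, and the intermediate
    point is interior: this is what lets one work on maximal intervals whose
    endpoints lie on a free boundary. *)
Lemma mean_value (f df : R -> R) (a b : R) :
  a < b ->
  (forall x, a < x < b -> is_derive f x (df x)) ->
  (forall x, a <= x <= b -> continuous f x) ->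
  exists z, a < z < b /\ f b - f a = df z * (b - a).
Proof.
  intros Hab Hd Hc.
  assert (pr1 : forall c, a < c < b -> derivable_pt f c).
  { intros c Hcc. exists (df c). now apply is_derive_Reals, Hd. }
  assert (pr2 : forall c, a < c < b -> derivable_pt id c).
  { intros c Hcc. apply derivable_pt_id. }
  destruct (MVT f id a b pr1 pr2 Hab) as [z [Hz E]].
  - intros c Hcc. now apply continuous_continuity_pt, Hc.
  - intros c Hcc. apply derivable_continuous_pt, derivable_pt_id.
  - exists z; split; [exact Hz|].
    rewrite (derive_pt_eq_0 f z (df z) (pr1 z Hz)) in E
      by now apply is_derive_Reals, Hd.
    rewrite (derive_pt_eq_0 id z 1 (pr2 z Hz)) in E
      by apply derivable_pt_lim_id.
    unfold id in E. lra.
Qed.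

Lemma derive_nonneg_le (f df : R -> R) (a b : R) :
  a <= b ->
  (forall x, a < x < b -> is_derive f x (df x)) ->
  (forall x, a < x < b -> 0 <= df x) ->
  (forall x, a <= x <= b -> continuous f x) ->
  f a <= f b.
Proof.
  intros [Hab|<-] Hd Hp Hc; [|lra].
  destruct (mean_value f df a b Hab Hd Hc) as [z [Hz E]].
  assert (0 <= df z * (b - a)) by (apply Rmult_le_pos; [now apply Hp|lra]).
  lra.
Qed.

Lemma last_nonpos (D : R -> R) (a b : R) :
  a <= b -> (forall t, a <= t <= b -> continuous D t) ->
  D a <= 0 -> 0 < D b ->
  exists t, a <= t < b /\ D t <= 0 /\ forall s, t < s <= b -> 0 < D s.
Proof.
  intros Hab Hc Ha Hb.
  destruct (completeness (fun t => a <= t <= b /\ D t <= 0)) as [t [Ht1 Ht2]].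
  { exists b. intros t [Ht _]. lra. }
  { exists a. split; [lra|exact Ha]. }
  assert (Hat : a <= t) by (apply Ht1; split; [lra|exact Ha]).
  assert (Htb : t <= b) by (apply Ht2; intros s [Hs _]; lra).
  assert (HDt : D t <= 0).
  { destruct (Rle_dec (D t) 0) as [H|H]; [exact H|exfalso].
    apply Rnot_le_lt in H.
    destruct (proj1 (continuous_epsP D t) (Hc t (conj Hat Htb)) (D t) H)
      as [d [Hd0 Hd]].
    assert (t <= t - d / 2); [|lra].
    apply Ht2. intros s [Hs HDs].
    destruct (Rle_dec s (t - d / 2)) as [Hs'|Hs']; [exact Hs'|exfalso].
    apply Rnot_le_lt in Hs'.
    assert (Hst : s <= t) by (apply Ht1; split; [lra|exact HDs]).
    assert (Rabs (D s - D t) < D t).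
    { apply Hd. apply Rabs_def1; lra. }
    apply Rabs_def2 in H0. lra. }
  exists t. split; [|split; [exact HDt|]].
  - split; [exact Hat|]. destruct Htb as [H|H]; [exact H|]. subst t. lra.
  - intros s Hs. apply Rnot_le_lt. intros HDs.
    assert (s <= t); [|lra]. apply Ht1. split; [lra|exact HDs].
Qed.

(** A one-sided Gronwall estimate: the derivative is controlled only while [D] is
    positive, which is all that a dissipative equation gives for the difference
    of two solutions. *)
Lemma growth_while_positive (D dD : R -> R) (M a b : R) :
  0 <= M -> a <= b ->
  (forall t, a <= t <= b -> continuous D t) ->
  (forall t, a < t < b -> is_derive D t (dD t)) ->
  (forall t, a < t < b -> 0 < D t -> dD t <= M) ->
  D a <= 0 -> D b <= M * (b - a).
Proof.
  intros HM Hab Hc Hd Hb Ha.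
  apply Rnot_lt_le. intros Hlt.
  assert (HMab : 0 <= M * (b - a)) by (apply Rmult_le_pos; lra).
  destruct (last_nonpos D a b Hab Hc Ha) as [t [Ht [HDt Hpos]]]; [lra|].
  destruct (mean_value D dD t b) as [z [Hz E]]; [lra| | |].
  - intros x Hx. apply Hd; lra.
  - intros x Hx. apply Hc; lra.
  - assert (dD z <= M) by (apply Hb; [lra|apply Hpos; lra]).
    assert (dD z * (b - t) <= M * (b - a)); [|lra].
    apply Rle_trans with (M * (b - t)).
    + apply Rmult_le_compat_r; lra.
    + apply Rmult_le_compat_l; lra.
Qed.

Lemma first_nonneg (D : R -> R) (a b : R) :
  a <= b -> (forall t, a <= t <= b -> continuous D t) ->
  D a < 0 -> 0 <= D b ->
  exists t, a < t <= b /\ 0 <= D t /\ forall s, a <= s < t -> D s < 0.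
Proof.
  intros Hab Hc Ha Hb.
  destruct (last_nonpos (fun t => - D (- t)) (- b) (- a)) as [t [Ht [HDt Hneg]]].
  - lra.
  - intros t Ht.
    apply (continuous_opp (V := R_NormedModule) (fun t : R => D (- t))).
    apply (continuous_comp (fun t : R => - t) D).
    + apply (continuous_opp (V := R_NormedModule) (fun t : R => t)).
      apply continuous_id.
    + apply Hc; lra.
  - rewrite Ropp_involutive. lra.
  - rewrite Ropp_involutive. lra.
  - exists (- t). repeat split; try lra.
    intros s Hs. specialize (Hneg (- s)). rewrite Ropp_involutive in Hneg. lra.
Qed.

(** * Limits of approximate solutions *)

(** Locally uniform closeness of the derivatives to the single number [l] is enough;
    the mean value inequality passes to the pointwise limit. *)
Lemma is_derive_limit (y d : nat -> R -> R) (z : R -> R) (s l : R) :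
  (forall t, is_lim_seq (fun n => y n t) (z t)) ->
  (forall eps, 0 < eps -> exists (N : nat) (r : R), 0 < r /\
     forall n t, (N <= n)%nat -> Rabs (t - s) < r ->
       is_derive (y n) t (d n t) /\ Rabs (d n t - l) <= eps) ->
  is_derive z s l.
Proof.
  intros Hlim H. apply is_derive_Reals. intros eps Heps.
  destruct (H (eps / 2)) as [N [r [Hr Hn]]]; [lra|].
  exists (mkposreal r Hr). simpl. intros h Hh0 Hh.
  assert (Hbound : Rabs ((z (s + h) - z s) - l * h) <= eps / 2 * Rabs h).
  { assert (L : is_lim_seq (fun n => Rabs ((y n (s + h) - y n s) - l * h))
                  (Rabs ((z (s + h) - z s) - l * h))).
    { apply (is_lim_seq_abs _ (Finite _)).
      apply is_lim_seq_minus'; [|apply is_lim_seq_const].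
      apply is_lim_seq_minus'; apply Hlim. }
    refine (is_lim_seq_le_loc _ _ _ _ _ L
              (is_lim_seq_const (eps / 2 * Rabs h))).
    exists N. intros n Hnn.
    destruct (MVT_gen (y n) s (s + h) (d n)) as [x [Hx E]].
    - intros x Hx. apply Hn; [exact Hnn|].
      revert Hx. unfold Rmin, Rmax. destruct (Rle_dec s (s + h)); intros Hx;
        apply Rabs_def2 in Hh; apply Rabs_def1; lra.
    - intros x Hx. apply continuous_continuity_pt.
      apply is_derive_continuous with (d n x). apply Hn; [exact Hnn|].
      revert Hx. unfold Rmin, Rmax. destruct (Rle_dec s (s + h)); intros Hx;
        apply Rabs_def2 in Hh; apply Rabs_def1; lra.
    - rewrite E. replace (d n x * (s + h - s) - l * h) with ((d n x - l) * h)
        by ring.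
      rewrite Rabs_mult. apply Rmult_le_compat_r; [apply Rabs_pos|].
      apply Hn; [exact Hnn|].
      revert Hx. unfold Rmin, Rmax. destruct (Rle_dec s (s + h)); intros Hx;
        apply Rabs_def2 in Hh; apply Rabs_def1; lra. }
  replace ((z (s + h) - z s) / h - l) with (((z (s + h) - z s) - l * h) / h)
    by (field; exact Hh0).
  unfold Rdiv at 1. rewrite Rabs_mult, Rabs_inv.
  assert (0 < Rabs h) by now apply Rabs_pos_lt.
  apply Rle_lt_trans with (eps / 2 * Rabs h * / Rabs h).
  - apply Rmult_le_compat_r; [|exact Hbound]. left. now apply Rinv_0_lt_compat.
  - field_simplify; lra.
Qed.

Lemma is_lim_seq_small (e : nat -> R) (B eps : R) :
  is_lim_seq e 0 -> 0 <= B -> 0 < eps ->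
  exists N, forall n, (N <= n)%nat -> e n * B < eps.
Proof.
  intros He HB Heps.
  assert (Heps' : 0 < eps / (B + 1)) by (apply Rdiv_lt_0_compat; lra).
  destruct (proj2 (is_lim_seq_spec e 0) He (mkposreal _ Heps')) as [N HN].
  exists N. intros n Hn. specialize (HN n Hn). simpl in HN.
  rewrite Rminus_0_r in HN. apply Rabs_def2 in HN.
  apply Rle_lt_trans with (eps / (B + 1) * B).
  - apply Rmult_le_compat_r; lra.
  - apply Rmult_lt_reg_r with (B + 1); [lra|]. field_simplify; nra.
Qed.

(** Both limit passages below, Picard iteration and the removal of the truncation of
    the power, are instances: [e n] is the rate, and the weight [W] absorbs growth in
    [s].  The equation is imposed for [s > 0] only, so that solutions can be extended
    by [0] to the left and remain continuous on the whole line. *)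
Lemma approximate_solutions_converge
  (k phi W : R -> R) (y d : nat -> R -> R) (e : nat -> R) :
  (forall s, continuous k s) -> (forall v, continuous phi v) ->
  (forall s, continuous W s) -> (forall s, 0 <= W s) ->
  is_lim_seq e 0 ->
  (forall n s, continuous (y n) s) ->
  (forall n s, 0 < s -> is_derive (y n) s (d n s)) ->
  (forall n s, 0 < s -> Rabs (d n s - (k s - phi (y n s))) <= e n * W s) ->
  (forall n i s, (n <= i)%nat -> Rabs (y n s - y i s) <= e n * W s) ->
  exists z : R -> R,
    (forall n s, Rabs (y n s - z s) <= e n * W s) /\
    (forall s, continuous z s) /\
    (forall s, 0 < s -> is_derive z s (k s - phi (z s))).
Proof.
  intros Hk Hphi HW HW0 He Hyc Hyd Happ Hcau.
  set (z := fun s => real (Lim_seq (fun n => y n s))).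
  assert (Hlim : forall s, is_lim_seq (fun n => y n s) (z s)).
  { intros s. apply Lim_seq_correct'. apply ex_lim_seq_cauchy_corr.
    intros eps.
    destruct (is_lim_seq_small e (W s) (eps / 2) He (HW0 s)) as [N HN];
      [apply is_pos_div_2|].
    exists N. intros n i Hn Hi.
    assert (H1 := Hcau N n s Hn). assert (H2 := Hcau N i s Hi).
    assert (H3 := HN N (le_n N)).
    replace (y n s - y i s) with (- (y N s - y n s) + (y N s - y i s)) by ring.
    eapply Rle_lt_trans; [apply Rabs_triang|]. rewrite Rabs_Ropp. lra. }
  assert (Hz : forall n s, Rabs (y n s - z s) <= e n * W s).
  { intros n s.
    assert (L : is_lim_seq (fun i => Rabs (y n s - y i s)) (Rabs (y n s - z s))).
    { apply (is_lim_seq_abs _ (Finite _)).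
      apply is_lim_seq_minus'; [apply is_lim_seq_const|apply Hlim]. }
    refine (is_lim_seq_le_loc _ _ _ _ _ L (is_lim_seq_const (e n * W s))).
    exists n. intros i Hi. now apply Hcau. }
  assert (HWb : forall s, exists r, 0 < r /\
            forall t, Rabs (t - s) < r -> W t <= W s + 1).
  { intros s. destruct (proj1 (continuous_epsP W s) (HW s) 1) as [r [Hr H]];
      [lra|].
    exists r; split; [exact Hr|]. intros t Ht.
    specialize (H t Ht). apply Rabs_def2 in H. lra. }
  assert (Hunif : forall s eps, 0 < eps -> exists (N : nat) (r : R), 0 < r /\
            forall n t, (N <= n)%nat -> Rabs (t - s) < r -> e n * W t < eps).
  { intros s eps Heps. destruct (HWb s) as [r [Hr Hb]].
    destruct (is_lim_seq_small (fun n => Rabs (e n)) (W s + 1) eps) as [N HN].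
    - rewrite <- Rabs_R0. now apply (is_lim_seq_abs _ (Finite 0)).
    - specialize (HW0 s). lra.
    - exact Heps.
    - exists N, r. split; [exact Hr|]. intros n t Hn Ht.
      eapply Rle_lt_trans; [|apply (HN n Hn)].
      apply Rle_trans with (Rabs (e n) * W t).
      + apply Rmult_le_compat_r; [apply HW0|apply Rle_abs].
      + apply Rmult_le_compat_l; [apply Rabs_pos|now apply Hb]. }
  assert (Hzc : forall s, continuous z s).
  { intros s. apply continuous_epsP. intros eps Heps.
    destruct (Hunif s (eps / 3)) as [N [r [Hr H]]]; [lra|].
    destruct (proj1 (continuous_epsP (y N) s) (Hyc N s) (eps / 3))
      as [r' [Hr' H']]; [lra|].
    exists (Rmin r r'). split; [now apply Rmin_pos|]. intros t Ht.
    assert (Ht1 := Rlt_le_trans _ _ _ Ht (Rmin_l _ _)).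
    assert (Ht2 := Rlt_le_trans _ _ _ Ht (Rmin_r _ _)).
    specialize (H' t Ht2). assert (A := H N t (le_n N) Ht1).
    assert (B := H N s (le_n N)). rewrite Rminus_diag, Rabs_R0 in B.
    specialize (B Hr). assert (C := Hz N t). assert (D := Hz N s).
    replace (z t - z s) with
      (- (y N t - z t) + ((y N t - y N s) + (y N s - z s))) by ring.
    eapply Rle_lt_trans; [apply Rabs_triang|]. rewrite Rabs_Ropp.
    assert (T := Rabs_triang (y N t - y N s) (y N s - z s)). lra. }
  exists z. split; [exact Hz|]. split; [exact Hzc|].
  intros s Hs. apply (is_derive_limit y d z s); [exact Hlim|].
  intros eps Heps.
  destruct (proj1 (continuous_epsP phi (z s)) (Hphi (z s)) (eps / 3))
    as [rho [Hrho Hp]]; [lra|].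
  destruct (proj1 (continuous_epsP z s) (Hzc s) (rho / 2)) as [r1 [Hr1 H1]];
    [lra|].
  destruct (proj1 (continuous_epsP k s) (Hk s) (eps / 3)) as [r2 [Hr2 H2]];
    [lra|].
  destruct (Hunif s (Rmin (eps / 3) (rho / 2))) as [N [r3 [Hr3 H3]]].
  { apply Rmin_pos; lra. }
  exists N, (Rmin s (Rmin r1 (Rmin r2 r3))).
  split; [repeat apply Rmin_pos; lra|].
  intros n t Hn Ht.
  assert (T1 := Rlt_le_trans _ _ _ Ht (Rmin_l _ _)).
  assert (T := Rlt_le_trans _ _ _ Ht (Rmin_r _ _)). clear Ht.
  assert (T2 := Rlt_le_trans _ _ _ T (Rmin_l _ _)).
  assert (T' := Rlt_le_trans _ _ _ T (Rmin_r _ _)). clear T.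
  assert (T3 := Rlt_le_trans _ _ _ T' (Rmin_l _ _)).
  assert (T4 := Rlt_le_trans _ _ _ T' (Rmin_r _ _)). clear T'.
  assert (Ht0 : 0 < t) by (apply Rabs_def2 in T1; lra).
  split; [now apply Hyd|].
  assert (Ee := H3 n t Hn T4).
  assert (Ee1 := Rlt_le_trans _ _ _ Ee (Rmin_l _ _)).
  assert (Ee2 := Rlt_le_trans _ _ _ Ee (Rmin_r _ _)).
  assert (A := Happ n t Ht0).
  assert (B : Rabs (phi (y n t) - phi (z s)) < eps / 3).
  { apply Hp. replace (y n t - z s) with ((y n t - z t) + (z t - z s)) by ring.
    eapply Rle_lt_trans; [apply Rabs_triang|].
    specialize (H1 t T2). assert (C := Hz n t). lra. }
  specialize (H2 t T3).
  replace (d n t - (k s - phi (z s))) with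
    ((d n t - (k t - phi (y n t))) + ((k t - k s) + - (phi (y n t) - phi (z s))))
    by ring.
  eapply Rle_trans; [apply Rabs_triang|].
  assert (X := Rabs_triang (k t - k s) (- (phi (y n t) - phi (z s)))).
  rewrite Rabs_Ropp in X. lra.
Qed.

Lemma lipschitz_continuous (f : R -> R) (L : R) :
  0 < L -> (forall a b, Rabs (f a - f b) <= L * Rabs (a - b)) ->
  forall x, continuous f x.
Proof.
  intros HL H x. apply continuous_epsP. intros eps Heps.
  exists (eps / L). split; [now apply Rdiv_lt_0_compat|]. intros y Hy.
  eapply Rle_lt_trans; [apply H|].
  apply Rmult_lt_reg_r with (/ L); [now apply Rinv_0_lt_compat|].
  replace (L * Rabs (y - x) * / L) with (Rabs (y - x)) by (field; lra).
  exact Hy.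
Qed.

Lemma Rmax_lipschitz (d a b : R) : Rabs (Rmax a d - Rmax b d) <= 1 * Rabs (a - b).
Proof.
  unfold Rmax. destruct (Rle_dec a d), (Rle_dec b d);
    unfold Rabs; repeat destruct Rcase_abs; lra.
Qed.

Lemma Rmin_lipschitz (d a b : R) : Rabs (Rmin a d - Rmin b d) <= 1 * Rabs (a - b).
Proof.
  unfold Rmin. destruct (Rle_dec a d), (Rle_dec b d);
    unfold Rabs; repeat destruct Rcase_abs; lra.
Qed.

Lemma continuous_Rmax_cst (d x : R) : continuous (fun t => Rmax t d) x.
Proof.
  apply (lipschitz_continuous _ 1); [lra|]. intros a b. apply Rmax_lipschitz.
Qed.

(** * Existence for the Lipschitz equation *)

(** [Rmax s 0] freezes the iterates at [0] on the left half line. *)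
Fixpoint picard (k phi : R -> R) (n : nat) (s : R) : R :=
  match n with
  | O => 0
  | S n => RInt (fun t => k t - phi (picard k phi n t)) 0 (Rmax s 0)
  end.

Lemma primitive_is_derive (g : R -> R) (s : R) :
  (forall t, continuous g t) -> is_derive (fun b => RInt g 0 b) s (g s).
Proof.
  intros Hg. apply (is_derive_RInt g (fun b => RInt g 0 b) 0 s); [|apply Hg].
  apply filter_forall. intros b. apply (RInt_correct (V := R_CompleteNormedModule)).
  apply (ex_RInt_continuous (V := R_CompleteNormedModule)). intros; apply Hg.
Qed.

Lemma derive_bound_le (D dD G dG : R -> R) (s : R) :
  0 <= s ->
  (forall t, 0 < t < s -> is_derive D t (dD t)) ->
  (forall t, 0 <= t <= s -> continuous D t) ->
  (forall t, 0 < t < s -> is_derive G t (dG t)) ->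
  (forall t, 0 <= t <= s -> continuous G t) ->
  (forall t, 0 < t < s -> Rabs (dD t) <= dG t) ->
  D 0 = 0 -> 0 <= G 0 -> Rabs (D s) <= G s.
Proof.
  intros Hs HD HDc HG HGc Hle H0 HG0. apply Rabs_le. split.
  - assert (0 <= G s + D s); [|lra].
    apply Rle_trans with (G 0 + D 0); [lra|].
    apply (derive_nonneg_le (fun t => G t + D t) (fun t => dG t + dD t));
      [exact Hs| | |].
    + intros t Ht. apply (is_derive_plus (V := R_NormedModule)); auto.
    + intros t Ht. specialize (Hle t Ht).
      assert (X := Rle_abs (- dD t)). rewrite Rabs_Ropp in X. lra.
    + intros t Ht. apply (continuous_plus (V := R_NormedModule)); auto.
  - assert (0 <= G s - D s); [|lra].
    apply Rle_trans with (G 0 - D 0); [lra|].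
    apply (derive_nonneg_le (fun t => G t - D t) (fun t => dG t - dD t));
      [exact Hs| | |].
    + intros t Ht. apply (is_derive_minus (V := R_NormedModule)); auto.
    + intros t Ht. specialize (Hle t Ht).
      assert (X := Rle_abs (dD t)). lra.
    + intros t Ht. apply (continuous_minus (V := R_NormedModule)); auto.
Qed.

Section Picard.
Variables (k phi : R -> R) (M L : R).
Hypothesis Hk : forall s, continuous k s.
Hypothesis HM : forall s, Rabs (k s) <= M.
Hypothesis HL : 0 < L.
Hypothesis Hphi : forall a b, Rabs (phi a - phi b) <= L * Rabs (a - b).

Lemma picard_continuous n s : continuous (picard k phi n) s.
Proof.
  revert s. induction n as [|n IH]; intros s.
  - apply continuous_const.
  - simpl.
    apply (continuous_comp (fun s => Rmax s 0)
      (fun b => RInt (fun t => k t - phi (picard k phi n t)) 0 b)).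
    + apply continuous_Rmax_cst.
    + eapply is_derive_continuous. apply primitive_is_derive. intros t.
      apply (continuous_minus (V := R_NormedModule)); [apply Hk|].
      apply (continuous_comp (picard k phi n) phi); [apply IH|].
      now apply lipschitz_continuous with L.
Qed.

Lemma picard_derive n s :
  0 < s -> is_derive (picard k phi (S n)) s (k s - phi (picard k phi n s)).
Proof.
  intros Hs.
  apply (is_derive_ext_loc
    (fun b => RInt (fun t => k t - phi (picard k phi n t)) 0 b)).
  - exists (mkposreal s Hs). intros t Ht. simpl.
    change (Rabs (t - s) < s) in Ht. apply Rabs_def2 in Ht.
    rewrite Rmax_left; [reflexivity|lra].
  - apply (primitive_is_derive (fun t => k t - phi (picard k phi n t))).
    intros t.
    apply (continuous_minus (V := R_NormedModule)); [apply Hk|].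
    apply (continuous_comp (picard k phi n) phi); [apply picard_continuous|].
    now apply lipschitz_continuous with L.
Qed.

Lemma picard_nonpos n s : s <= 0 -> picard k phi n s = 0.
Proof.
  intros Hs. destruct n as [|n]; [reflexivity|]. simpl.
  rewrite Rmax_right by exact Hs. now rewrite RInt_point.
Qed.

(* In the norm weighted by [exp (2 L s)] the iteration contracts with ratio 1/2, so
   it converges on the whole half line at once; [C] bounds the first step. *)
Let C := (M + Rabs (phi 0)) / (2 * L).
Let W := fun s => exp (2 * L * Rmax s 0).

Lemma exp_weight_derive (A t : R) :
  is_derive (fun s => A * exp (2 * L * s)) t (2 * L * (A * exp (2 * L * t))).
Proof. auto_derive; [exact I|ring]. Qed.

Lemma picard_C_nonneg : 0 <= C.
Proof.
  unfold C. apply Rdiv_le_0_compat; [|lra].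
  assert (0 <= M) by (eapply Rle_trans; [apply Rabs_pos|apply (HM 0)]).
  assert (X := Rabs_pos (phi 0)). lra.
Qed.

Lemma picard_step n s :
  Rabs (picard k phi (S n) s - picard k phi n s) <= C * (1 / 2) ^ n * W s.
Proof.
  assert (HC := picard_C_nonneg).
  assert (Hpow : forall n, 0 <= (1 / 2) ^ n) by (intros; apply pow_le; lra).
  revert s. induction n as [|n IH]; intros s.
  all: destruct (Rle_dec s 0) as [Hs|Hs];
    [ rewrite !picard_nonpos by exact Hs; rewrite Rminus_diag, Rabs_R0;
      apply Rmult_le_pos; [now apply Rmult_le_pos|left; apply exp_pos] | ].
  all: apply Rnot_le_lt in Hs; unfold W; rewrite Rmax_left by lra.
  - apply (derive_bound_le
      (fun s => picard k phi 1 s - picard k phi 0 s)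
      (fun t => k t - phi 0)
      (fun s => C * (1 / 2) ^ 0 * exp (2 * L * s))
      (fun t => 2 * L * (C * (1 / 2) ^ 0 * exp (2 * L * t)))); try lra.
    + intros t Ht. replace (k t - phi 0) with ((k t - phi 0) - 0) by ring.
      apply (is_derive_minus (V := R_NormedModule) (picard k phi 1)).
      * apply (picard_derive 0); lra.
      * apply (is_derive_const (V := R_NormedModule) 0).
    + intros t Ht.
      apply (continuous_minus (V := R_NormedModule)); apply picard_continuous.
    + intros t Ht. apply exp_weight_derive.
    + intros t Ht. eapply is_derive_continuous, exp_weight_derive.
    + intros t Ht.
      apply Rle_trans with (M + Rabs (phi 0)).
      * eapply Rle_trans; [apply Rabs_triang|]. rewrite Rabs_Ropp.
        specialize (HM t). lra.
      * replace (2 * L * (C * (1 / 2) ^ 0 * exp (2 * L * t)))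
          with ((M + Rabs (phi 0)) * exp (2 * L * t))
          by (unfold C; field; lra).
        assert (1 <= exp (2 * L * t)).
        { rewrite <- exp_0. left. apply exp_increasing. nra. }
        assert (0 <= M + Rabs (phi 0)); [|nra].
        assert (X := HM 0). assert (Y := Rabs_pos (k 0)).
        assert (Z := Rabs_pos (phi 0)). lra.
    + rewrite !picard_nonpos by lra. ring.
    + rewrite Rmult_0_r, exp_0. simpl. lra.
  - apply (derive_bound_le
      (fun s => picard k phi (S (S n)) s - picard k phi (S n) s)
      (fun t => (k t - phi (picard k phi (S n) t)) - (k t - phi (picard k phi n t)))
      (fun s => C * (1 / 2) ^ (S n) * exp (2 * L * s))
      (fun t => 2 * L * (C * (1 / 2) ^ (S n) * exp (2 * L * t)))); try lra.
    + intros t Ht.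
      apply (is_derive_minus (V := R_NormedModule) (picard k phi (S (S n))));
        apply picard_derive; lra.
    + intros t Ht.
      apply (continuous_minus (V := R_NormedModule)); apply picard_continuous.
    + intros t Ht. apply exp_weight_derive.
    + intros t Ht. eapply is_derive_continuous, exp_weight_derive.
    + intros t Ht. specialize (IH t). unfold W in IH.
      rewrite Rmax_left in IH by lra.
      replace (_ - _ - _) with
        (phi (picard k phi n t) - phi (picard k phi (S n) t)) by ring.
      eapply Rle_trans; [apply Hphi|]. rewrite Rabs_minus_sym.
      replace (2 * L * (C * (1 / 2) ^ (S n) * exp (2 * L * t)))
        with (L * (C * (1 / 2) ^ n * exp (2 * L * t))) by (simpl; field).
      apply Rmult_le_compat_l; lra.
    + rewrite !picard_nonpos by lra. ring.
    + apply Rmult_le_pos; [now apply Rmult_le_pos|left; apply exp_pos].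
Qed.

Lemma picard_cauchy n i s :
  (n <= i)%nat ->
  Rabs (picard k phi n s - picard k phi i s) <= 2 * C * (1 / 2) ^ n * W s.
Proof.
  intros Hni.
  assert (HC := picard_C_nonneg).
  assert (HW : 0 < W s) by apply exp_pos.
  assert (X : Rabs (picard k phi n s - picard k phi i s)
              <= 2 * C * ((1 / 2) ^ n - (1 / 2) ^ i) * W s).
  { induction Hni as [|i Hni IH].
    - rewrite !Rminus_diag, Rabs_R0. lra.
    - replace (picard k phi n s - picard k phi (S i) s) with
        ((picard k phi n s - picard k phi i s)
         + - (picard k phi (S i) s - picard k phi i s)) by ring.
      eapply Rle_trans; [apply Rabs_triang|]. rewrite Rabs_Ropp.
      assert (Y := picard_step i s). simpl pow. lra. }
  eapply Rle_trans; [exact X|].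
  apply Rmult_le_compat_r; [lra|]. apply Rmult_le_compat_l; [lra|].
  assert (0 <= (1 / 2) ^ i) by (apply pow_le; lra). lra.
Qed.

Lemma lipschitz_ode :
  exists y : R -> R,
    (forall s, continuous y s) /\ (forall s, s <= 0 -> y s = 0) /\
    (forall s, 0 < s -> is_derive y s (k s - phi (y s))).
Proof.
  assert (HC := picard_C_nonneg).
  assert (HWp : forall s, 0 < W s) by (intros; apply exp_pos).
  assert (Hpow : forall n, 0 <= (1 / 2) ^ n) by (intros; apply pow_le; lra).
  destruct (approximate_solutions_converge k phi W
    (fun n => picard k phi (S n))
    (fun n s => k s - phi (picard k phi n s))
    (fun n => 2 * C * (1 + L) * (1 / 2) ^ n)) as [z [Hz [Hzc Hzd]]].
  - exact Hk.
  - now apply lipschitz_continuous with L.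
  - intros s. unfold W. apply (continuous_comp (fun s => 2 * L * Rmax s 0) exp).
    + apply (continuous_scal_r (V := R_NormedModule) (2 * L) (fun s => Rmax s 0)).
      apply continuous_Rmax_cst.
    + apply continuous_exp.
  - intros s. left. apply HWp.
  - replace (Finite 0) with (Rbar_mult (2 * C * (1 + L)) 0)
      by (simpl; f_equal; ring).
    apply is_lim_seq_scal_l. apply is_lim_seq_geom.
    rewrite Rabs_pos_eq; lra.
  - intros n s. apply picard_continuous.
  - intros n s Hs. now apply picard_derive.
  - intros n s Hs.
    replace (_ - _) with
      (phi (picard k phi (S n) s) - phi (picard k phi n s)) by ring.
    eapply Rle_trans; [apply Hphi|].
    assert (X := picard_step n s).
    apply Rle_trans with (L * (C * (1 / 2) ^ n * W s)).
    + apply Rmult_le_compat_l; lra.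
    + assert (0 <= C * (1 / 2) ^ n * W s)
        by (apply Rmult_le_pos; [now apply Rmult_le_pos|left; apply HWp]).
      nra.
  - intros n i s Hni.
    eapply Rle_trans; [apply picard_cauchy; lia|].
    assert (0 <= C * (1 / 2) ^ n * W s)
        by (apply Rmult_le_pos; [now apply Rmult_le_pos|left; apply HWp]).
    simpl pow. nra.
  - exists z. split; [exact Hzc|]. split; [|exact Hzd].
    intros s Hs.
    (* every iterate vanishes on the half line, hence so does the limit *)
    apply Rabs_eq_0, Rle_antisym; [|apply Rabs_pos].
    apply Rnot_lt_le. intros Hpos.
    destruct (is_lim_seq_small (fun n => (1 / 2) ^ n)
      (2 * C * (1 + L) * W s) (Rabs (z s))) as [N HN].
    + apply is_lim_seq_geom. rewrite Rabs_pos_eq; lra.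
    + apply Rmult_le_pos; [|left; apply HWp]. nra.
    + exact Hpos.
    + specialize (HN N (le_n N)). specialize (Hz N s).
      rewrite picard_nonpos, Rminus_0_l, Rabs_Ropp in Hz by exact Hs. lra.
Qed.

End Picard.

(** * Powers *)

Lemma Rpower_pos (x a : R) : 0 < Rpower x a.
Proof. apply exp_pos. Qed.

Lemma rpow_pos (x a : R) : 0 < x -> rpow x a = Rpower x a.
Proof. intros H. unfold rpow. destruct (Rlt_dec 0 x); [reflexivity|lra]. Qed.

Lemma rpow_nonpos (x a : R) : x <= 0 -> rpow x a = 0.
Proof. intros H. unfold rpow. destruct (Rlt_dec 0 x); [lra|reflexivity]. Qed.

Lemma rpow_nonneg (x a : R) : 0 <= rpow x a.
Proof.
  unfold rpow. destruct (Rlt_dec 0 x); [left; apply Rpower_pos|lra].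
Qed.

Lemma rpow_le (x y a : R) : 0 <= a -> x <= y -> rpow x a <= rpow y a.
Proof.
  intros Ha Hxy. destruct (Rlt_dec 0 x) as [Hx|Hx].
  - rewrite !rpow_pos by lra. apply Rle_Rpower_l; lra.
  - rewrite (rpow_nonpos x) by lra. apply rpow_nonneg.
Qed.

Lemma Rpower_inv_exp (x a : R) : 0 < x -> a <> 0 -> Rpower (Rpower x (1 / a)) a = x.
Proof.
  intros Hx Ha. rewrite Rpower_mult. replace (1 / a * a) with 1 by (field; exact Ha).
  now apply Rpower_1.
Qed.

Lemma Rpower_is_derive (x a : R) :
  0 < x -> is_derive (fun t => Rpower t a) x (a * Rpower x (a - 1)).
Proof. intros Hx. now apply is_derive_Reals, derivable_pt_lim_power. Qed.

Lemma rpow_is_derive (x a : R) :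
  0 < x -> is_derive (fun t => rpow t a) x (a * Rpower x (a - 1)).
Proof.
  intros Hx. apply (is_derive_ext_loc (fun t => Rpower t a)).
  - exists (mkposreal x Hx). intros t Ht.
    change (Rabs (t - x) < x) in Ht. apply Rabs_def2 in Ht.
    rewrite rpow_pos; [reflexivity|lra].
  - now apply Rpower_is_derive.
Qed.

Lemma rpow_continuous_pos (x a : R) : 0 < x -> continuous (fun t => rpow t a) x.
Proof. intros Hx. eapply is_derive_continuous. now apply rpow_is_derive. Qed.

Lemma rpow_continuous (x a : R) : 0 < a -> continuous (fun t => rpow t a) x.
Proof.
  intros Ha. destruct (Rlt_dec 0 x) as [Hx|Hx].
  - now apply rpow_continuous_pos.
  - apply continuous_epsP. intros eps Heps.
    exists (Rpower eps (1 / a)). split; [apply Rpower_pos|]. intros y Hy.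
    rewrite (rpow_nonpos x), Rminus_0_r by lra.
    rewrite Rabs_pos_eq by apply rpow_nonneg.
    destruct (Rlt_dec 0 y) as [Hy0|Hy0].
    + rewrite rpow_pos by exact Hy0.
      rewrite <- (Rpower_inv_exp eps a) by lra.
      apply Rlt_Rpower_l; [exact Ha|]. apply Rabs_def2 in Hy. lra.
    + rewrite rpow_nonpos by lra. exact Heps.
Qed.

Lemma Rpower_le_neg_exp (x y a : R) :
  a <= 0 -> 0 < x -> x <= y -> Rpower y a <= Rpower x a.
Proof.
  intros Ha Hx Hxy. unfold Rpower.
  assert (ln x <= ln y) by (apply ln_le; lra).
  destruct (Req_dec (a * ln y) (a * ln x)) as [->|Hne]; [lra|].
  left. apply exp_increasing. nra.
Qed.

(** Cutting the power off at [d] makes it Lipschitz and keeps it nondecreasing. *)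
Lemma rpow_truncated_lipschitz (d b x y : R) :
  0 < d -> 0 < b < 1 ->
  Rabs (rpow (Rmax x d) b - rpow (Rmax y d) b)
  <= b * Rpower d (b - 1) * Rabs (x - y).
Proof.
  intros Hd Hb.
  assert (Hx : d <= Rmax x d) by apply Rmax_r.
  assert (Hy : d <= Rmax y d) by apply Rmax_r.
  assert (Hmm : forall z, Rmin (Rmax y d) (Rmax x d) <= z -> d <= z).
  { intros z Hz. apply Rle_trans with (2 := Hz). now apply Rmin_glb. }
  destruct (MVT_gen (fun t => rpow t b) (Rmax y d) (Rmax x d)
              (fun t => b * Rpower t (b - 1))) as [z [Hz E]].
  - intros z Hz. apply rpow_is_derive.
    assert (d <= z) by (apply Hmm; lra). lra.
  - intros z Hz. apply continuous_continuity_pt, rpow_continuous. lra.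
  - rewrite E, Rabs_mult.
    apply Rmult_le_compat; try apply Rabs_pos.
    + rewrite Rabs_pos_eq.
      2: { apply Rmult_le_pos; [lra|left; apply Rpower_pos]. }
      apply Rmult_le_compat_l; [lra|].
      apply Rpower_le_neg_exp; [lra|exact Hd|]. apply Hmm; lra.
    + eapply Rle_trans; [apply Rmax_lipschitz|]. lra.
Qed.

(** * The dissipative equation with a power nonlinearity *)

(** The power is not Lipschitz at [0].  The solutions for truncated powers are
    nevertheless Cauchy: the truncations are uniformly close and nondecreasing, so
    the dissipative sign keeps two solutions together, independently of the Lipschitz
    constants, which blow up. *)
Lemma power_ode (k : R -> R) (M C b : R) :
  (forall s, continuous k s) -> (forall s, 0 <= k s <= M) ->
  0 < C -> 0 < b < 1 ->
  exists y : R -> R,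
    (forall s, continuous y s) /\ (forall s, s <= 0 -> y s = 0) /\
    (forall s, 0 <= y s) /\
    (forall s, 0 < s -> is_derive y s (k s - C * rpow (y s) b)).
Proof.
  intros Hk HkM HC Hb.
  set (eta := fun n : nat => / (INR n + 1)).
  assert (Heta : forall n, 0 < eta n).
  { intros n. apply Rinv_0_lt_compat. assert (X := pos_INR n). lra. }
  set (dl := fun n => Rpower (eta n) (1 / b)).
  assert (Hdl : forall n, 0 < dl n) by (intros; apply Rpower_pos).
  assert (Hdlb : forall n, rpow (dl n) b = eta n).
  { intros n. rewrite rpow_pos by apply Hdl. unfold dl.
    apply Rpower_inv_exp; [apply Heta|lra]. }
  set (phi := fun v => C * rpow v b).
  set (phin := fun n v => C * rpow (Rmax v (dl n)) b).
  assert (Hphi_mono : forall u v, u <= v -> phi u <= phi v).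
  { intros u v Huv. apply Rmult_le_compat_l; [lra|]. apply rpow_le; lra. }
  assert (Hphi_lo : forall n v, phi v <= phin n v).
  { intros n v. apply Rmult_le_compat_l; [lra|]. apply rpow_le; [lra|apply Rmax_l]. }
  assert (Hphi_hi : forall n v, phin n v <= phi v + C * eta n).
  { intros n v. unfold phin, phi. rewrite <- Hdlb, <- Rmult_plus_distr_l.
    apply Rmult_le_compat_l; [lra|].
    assert (A := rpow_nonneg v b). assert (B := rpow_nonneg (dl n) b).
    unfold Rmax. destruct (Rle_dec v (dl n)); lra. }
  assert (Hex : forall n, exists y : R -> R,
    (forall s, continuous y s) /\ (forall s, s <= 0 -> y s = 0) /\
    (forall s, 0 < s -> is_derive y s (k s - phin n (y s)))).
  { intros n. apply (lipschitz_ode k (phin n) M (C * (b * Rpower (dl n) (b - 1)))).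
    - exact Hk.
    - intros s. rewrite Rabs_pos_eq; apply HkM.
    - apply Rmult_lt_0_compat; [lra|].
      apply Rmult_lt_0_compat; [lra|apply Rpower_pos].
    - intros u v. unfold phin. rewrite <- Rmult_minus_distr_l, Rabs_mult.
      rewrite (Rabs_pos_eq C) by lra. rewrite Rmult_assoc.
      apply Rmult_le_compat_l; [lra|].
      apply rpow_truncated_lipschitz; [apply Hdl|exact Hb]. }
  destruct (functional_choice _ Hex) as [y Hy]. clear Hex.
  (* where [y n > y i], monotonicity of the power leaves only the truncation error
     of [phin i] in the derivative of the difference *)
  assert (Hdrift : forall n i s, 0 < s ->
            y n s - y i s <= C * eta i * s).
  { intros n i s Hs.
    destruct (Hy n) as [Hnc [Hn0 Hnd]]. destruct (Hy i) as [Hic [Hi0 Hid]].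
    replace (C * eta i * s) with (C * eta i * (s - 0)) by ring.
    apply (growth_while_positive (fun t => y n t - y i t)
      (fun t => (k t - phin n (y n t)) - (k t - phin i (y i t))) (C * eta i) 0 s).
    - apply Rmult_le_pos; [lra|left; apply Heta].
    - lra.
    - intros t _. apply (continuous_minus (V := R_NormedModule)); auto.
    - intros t Ht. apply (is_derive_minus (V := R_NormedModule));
        [apply Hnd|apply Hid]; lra.
    - intros t Ht HD.
      assert (A := Hphi_lo n (y n t)). assert (B := Hphi_hi i (y i t)).
      assert (D := Hphi_mono (y i t) (y n t)). lra.
    - rewrite Hn0, Hi0 by lra. lra. }
  set (W := fun s => 1 + Rmax s 0).
  assert (HW1 : forall s, 1 <= W s).
  { intros s. unfold W. assert (X := Rmax_r s 0). lra. }
  destruct (approximate_solutions_converge k phi W y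
     (fun n s => k s - phin n (y n s)) (fun n => C * eta n))
    as [z [Hz [Hzc Hzd]]].
  - exact Hk.
  - intros v. apply (continuous_scal_r (V := R_NormedModule) C (fun v => rpow v b)).
    apply rpow_continuous; lra.
  - intros s. apply (continuous_plus (V := R_NormedModule));
      [apply continuous_const|apply continuous_Rmax_cst].
  - intros s. specialize (HW1 s). lra.
  - replace (Finite 0) with (Rbar_mult C 0) by (simpl; f_equal; ring).
    apply is_lim_seq_scal_l.
    apply (is_lim_seq_inv (fun n => INR n + 1) p_infty); [|discriminate].
    apply is_lim_seq_plus with p_infty 1;
      [apply is_lim_seq_INR|apply is_lim_seq_const|reflexivity].
  - intros n s. apply Hy.
  - intros n s Hs. now apply Hy.
  - intros n s Hs.
    replace (_ - _) with (- (phin n (y n s) - phi (y n s))) by ring.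
    assert (A := Hphi_lo n (y n s)). assert (B := Hphi_hi n (y n s)).
    rewrite Rabs_Ropp, Rabs_pos_eq by lra.
    assert (0 < C * eta n) by (apply Rmult_lt_0_compat; auto).
    specialize (HW1 s). nra.
  - intros n i s Hni.
    assert (HCe : 0 < C * eta n) by (apply Rmult_lt_0_compat; auto).
    destruct (Rle_dec s 0) as [Hs|Hs].
    + rewrite (proj1 (proj2 (Hy n))), (proj1 (proj2 (Hy i))) by exact Hs.
      rewrite Rminus_diag, Rabs_R0. specialize (HW1 s). nra.
    + apply Rnot_le_lt in Hs. unfold W. rewrite Rmax_left by lra.
      assert (Hin : eta i <= eta n).
      { apply Rinv_le_contravar; [assert (X := pos_INR n); lra|].
        apply Rplus_le_compat_r, le_INR, Hni. }
      assert (A := Hdrift n i s Hs). assert (B := Hdrift i n s Hs).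
      assert (C * eta i * s <= C * eta n * s).
      { apply Rmult_le_compat_r; [lra|]. apply Rmult_le_compat_l; lra. }
      apply Rabs_le. nra.
  - assert (Hz0 : forall s, s <= 0 -> z s = 0).
    { intros s Hs. apply Rabs_eq_0, Rle_antisym; [|apply Rabs_pos].
      apply Rnot_lt_le. intros Hpos.
      destruct (is_lim_seq_small eta (C * W s) (Rabs (z s))) as [N HN].
      - apply (is_lim_seq_inv (fun n => INR n + 1) p_infty); [|discriminate].
        apply is_lim_seq_plus with p_infty 1;
          [apply is_lim_seq_INR|apply is_lim_seq_const|reflexivity].
      - apply Rmult_le_pos; [lra|]. specialize (HW1 s). lra.
      - exact Hpos.
      - specialize (HN N (le_n N)). specialize (Hz N s).
        rewrite (proj1 (proj2 (Hy N))), Rminus_0_l, Rabs_Ropp in Hz by exact Hs.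
        lra. }
    exists z. split; [exact Hzc|]. split; [exact Hz0|]. split; [|exact Hzd].
    intros s. destruct (Rle_dec s 0) as [Hs|Hs]; [rewrite Hz0; lra|].
    apply Rnot_le_lt in Hs.
    assert (- z s <= 0 * (s - 0)); [|lra].
    apply (growth_while_positive (fun t => - z t)
      (fun t => - (k t - phi (z t))) 0 0 s); try lra.
    + intros t _. now apply (continuous_opp (V := R_NormedModule)).
    + intros t Ht. apply (is_derive_opp (V := R_NormedModule)), Hzd; lra.
    + intros t Ht Hneg. unfold phi. rewrite rpow_nonpos by lra.
      specialize (HkM t). lra.
    + rewrite Hz0; lra.
Qed.

(** At an interior zero a nonnegative solution would have zero derivative, while the
    equation gives it the derivative [k s]. *)
Lemma nonneg_solution_pos (y k : R -> R) (C b s : R) :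
  (forall s, 0 <= y s) -> 0 < s -> 0 < k s ->
  is_derive y s (k s - C * rpow (y s) b) -> 0 < y s.
Proof.
  intros Hy Hs Hk Hd.
  destruct (Hy s) as [H|H]; [exact H|exfalso].
  rewrite <- H, rpow_nonpos, Rmult_0_r, Rminus_0_r in Hd by lra.
  apply is_derive_Reals in Hd.
  destruct (Hd (k s) Hk) as [[d Hd0] Hdd]. simpl in Hdd.
  specialize (Hdd (- (d / 2))).
  assert (X : Rabs ((y (s + - (d / 2)) - y s) / - (d / 2) - k s) < k s).
  { apply Hdd; [lra|]. rewrite Rabs_Ropp, Rabs_pos_eq; lra. }
  rewrite <- H, Rminus_0_r in X. apply Rabs_def2 in X.
  assert (0 <= y (s + - (d / 2)) * / (d / 2)).
  { apply Rmult_le_pos; [apply Hy|]. left. apply Rinv_0_lt_compat; lra. }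
  replace (y (s + - (d / 2)) / - (d / 2)) with
    (- (y (s + - (d / 2)) * / (d / 2))) in X by (field; lra).
  lra.
Qed.

(** The backward orbit from [u = 1] exists and is positive by the two preceding
    lemmas; the last hypothesis makes the line of slope [lam] a barrier, and this is
    what forces [E 0 = 0]. *)
Lemma phase_plane_solution (K : R -> R) (p c lam M : R) :
  1 < p -> 0 < c -> 0 < lam ->
  (forall u, continuous K u) -> (forall u, 0 <= K u <= M) ->
  (forall u, 0 < u < 1 -> 0 < K u) ->
  (forall u, 0 < u < 1 -> K u <= (c - lam) * Rpower (lam * u) (1 / (p - 1))) ->
  exists E : R -> R,
    (forall u, continuous E u) /\ E 0 = 0 /\ E 1 = 0 /\
    (forall u, 0 < u < 1 -> 0 < E u) /\
    (forall u, 0 < u < 1 ->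
       is_derive E u (p / (p - 1) * (c * Rpower (E u) (1 / p) - K u))).
Proof.
  intros Hp Hc Hlam HKc HKM HKpos HKle.
  assert (Hkap : 0 < p / (p - 1)) by (apply Rdiv_lt_0_compat; lra).
  set (kap := p / (p - 1)) in *.
  assert (Hip : 0 < 1 / p < 1).
  { split; [apply Rdiv_lt_0_compat; lra|]. apply Rmult_lt_reg_r with p; [lra|].
    field_simplify; lra. }
  destruct (power_ode (fun s => kap * K (1 - s)) (kap * M) (kap * c) (1 / p))
    as [y [Hyc [Hy0 [Hyn Hyd]]]].
  - intros s. apply (continuous_scal_r (V := R_NormedModule) kap (fun s => K (1 - s))).
    apply (continuous_comp (fun s : R => 1 - s) K); [|apply HKc].
    apply (continuous_minus (V := R_NormedModule));
      [apply continuous_const|apply continuous_id].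
  - intros s. specialize (HKM (1 - s)). split.
    + apply Rmult_le_pos; lra.
    + apply Rmult_le_compat_l; lra.
  - apply Rmult_lt_0_compat; lra.
  - exact Hip.
  - assert (Hpos : forall s, 0 < s < 1 -> 0 < y s).
    { intros s Hs.
      apply (nonneg_solution_pos y (fun s => kap * K (1 - s)) (kap * c) (1 / p));
        [exact Hyn|lra| |apply Hyd; lra].
      apply Rmult_lt_0_compat; [lra|]. apply HKpos; lra. }
    (* the line of slope [lam] for the flux [Q^(p-1)], expressed for [Q^p] in the
       variable [s = 1 - u] *)
    set (Lam := fun s => Rpower (lam * (1 - s)) kap).
    assert (HLamd : forall s, s < 1 -> is_derive Lam s
       (- (kap * lam * Rpower (lam * (1 - s)) (1 / (p - 1))))).
    { intros s Hs. unfold Lam.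
      assert (Hls : 0 < lam * (1 - s)) by (apply Rmult_lt_0_compat; lra).
      replace (- (kap * lam * Rpower (lam * (1 - s)) (1 / (p - 1)))) with
        (scal (- lam) (kap * Rpower (lam * (1 - s)) (kap - 1))).
      - apply (is_derive_comp (V := R_NormedModule) (fun t => Rpower t kap)
                 (fun s => lam * (1 - s))).
        + now apply Rpower_is_derive.
        + auto_derive; [exact I|ring].
      - replace (kap - 1) with (1 / (p - 1)) by (unfold kap; field; lra).
        unfold scal; simpl; unfold mult; simpl. ring. }
    assert (HLamroot : forall s, s < 1 ->
       Rpower (Lam s) (1 / p) = Rpower (lam * (1 - s)) (1 / (p - 1))).
    { intros s Hs. unfold Lam. rewrite Rpower_mult. f_equal.
      unfold kap. field; lra. }
    assert (Hup : forall s, 0 < s < 1 -> y s <= Lam s).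
    { intros s Hs. assert (y s - Lam s <= 0 * (s - 0)); [|lra].
      apply (growth_while_positive (fun t => y t - Lam t)
        (fun t => (kap * K (1 - t) - kap * c * rpow (y t) (1 / p)) -
           - (kap * lam * Rpower (lam * (1 - t)) (1 / (p - 1)))) 0 0 s); try lra.
      - intros t Ht. apply (continuous_minus (V := R_NormedModule)); [apply Hyc|].
        eapply is_derive_continuous, HLamd; lra.
      - intros t Ht. apply (is_derive_minus (V := R_NormedModule));
          [apply Hyd; lra|apply HLamd; lra].
      - intros t Ht HD.
        assert (X : rpow (Lam t) (1 / p) <= rpow (y t) (1 / p))
          by (apply rpow_le; lra).
        rewrite rpow_pos, HLamroot in X by (lra || apply Rpower_pos).
        assert (Y := HKle (1 - t)). specialize (Y ltac:(lra)).
        assert (c * Rpower (lam * (1 - t)) (1 / (p - 1)) <= c * rpow (y t) (1 / p))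
          by (apply Rmult_le_compat_l; lra).
        assert (kap * (K (1 - t) - c * rpow (y t) (1 / p)
                  + lam * Rpower (lam * (1 - t)) (1 / (p - 1))) <= kap * 0).
        { apply Rmult_le_compat_l; lra. }
        lra.
      - rewrite Hy0 by lra. assert (X := Rpower_pos (lam * (1 - 0)) kap).
        unfold Lam. lra. }
    assert (Hy1 : y 1 = 0).
    { destruct (Hyn 1) as [H1|H1]; [exfalso|now symmetry].
      (* close to 1 the barrier is below half of the value of [y] at 1 *)
      destruct (proj1 (continuous_epsP y 1) (Hyc 1) (y 1 / 2)) as [d [Hd Hyl]];
        [lra|].
      set (e := Rpower (y 1 / 2) (1 / kap)).
      assert (He : 0 < e) by apply Rpower_pos.
      set (h := Rmin (d / 2) (Rmin (1 / 2) (e / lam))).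
      assert (Hh : 0 < h).
      { repeat apply Rmin_pos; try lra. now apply Rdiv_lt_0_compat. }
      assert (Hh1 : h <= d / 2) by apply Rmin_l.
      assert (Hh2 : h <= 1 / 2) by (eapply Rle_trans; [apply Rmin_r|apply Rmin_l]).
      assert (Hh3 : h <= e / lam) by (eapply Rle_trans; [apply Rmin_r|apply Rmin_r]).
      assert (A := Hup (1 - h) ltac:(lra)).
      specialize (Hyl (1 - h)).
      assert (B : Rabs (y (1 - h) - y 1) < y 1 / 2)
        by (apply Hyl; apply Rabs_def1; lra).
      apply Rabs_def2 in B.
      assert (Lam (1 - h) <= y 1 / 2); [|lra].
      unfold Lam. rewrite <- (Rpower_inv_exp (y 1 / 2) kap) by lra.
      apply Rle_Rpower_l; [lra|].
      replace (1 - (1 - h)) with h by ring. split.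
      - now apply Rmult_lt_0_compat.
      - fold e. replace e with (lam * (e / lam)) by (field; lra).
        apply Rmult_le_compat_l; lra. }
    exists (fun u => y (1 - u)). split; [|split; [|split; [|split]]].
    + intros u. apply (continuous_comp (fun u : R => 1 - u) y); [|apply Hyc].
      apply (continuous_minus (V := R_NormedModule));
        [apply continuous_const|apply continuous_id].
    + now rewrite Rminus_0_r.
    + apply Hy0; lra.
    + intros u Hu. apply Hpos; lra.
    + intros u Hu.
      replace (kap * (c * Rpower (y (1 - u)) (1 / p) - K u)) with
        (scal (- 1) (kap * K (1 - (1 - u)) - kap * c * rpow (y (1 - u)) (1 / p))).
      * apply (is_derive_comp (V := R_NormedModule) y (fun u => 1 - u)).
        -- apply Hyd; lra.
        -- auto_derive; [exact I|ring].
      * replace (1 - (1 - u)) with u by ring.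
        rewrite rpow_pos by (apply Hpos; lra).
        unfold scal; simpl; unfold mult; simpl. ring.
Qed.

(** [xi] is the time needed to go from [1/2] to [v].  Taking for [u x] the supremum of
    the values reached before [x], together with [0], inverts [xi] and at the same time
    extends the orbit by the equilibria when one of them is reached in finite time, so
    no case distinction on the convergence of the integral at [0] and [1] is needed. *)
Lemma heteroclinic (h : R -> R) :
  (forall v, 0 < v < 1 -> continuous h v) -> (forall v, 0 < v < 1 -> 0 < h v) ->
  exists u : R -> R,
    (forall x, 0 <= u x <= 1) /\ (forall x y, x <= y -> u x <= u y) /\
    (forall x, continuous u x) /\
    is_lim u m_infty 0 /\ is_lim u p_infty 1 /\
    (forall x, 0 < u x < 1 -> is_derive u x (h (u x))).
Proof.
  intros Hc Hp.
  set (xi := fun v => RInt (fun w => / h w) (1 / 2) v).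
  assert (Hhc : forall w, 0 < w < 1 -> continuous (fun w => / h w) w).
  { intros w Hw. apply (continuous_comp h (fun t => / t)); [now apply Hc|].
    apply continuous_Rinv. apply Rgt_not_eq, Hp, Hw. }
  assert (Hxid : forall v, 0 < v < 1 -> is_derive xi v (/ h v)).
  { intros v Hv. apply (is_derive_RInt (fun w => / h w) xi (1 / 2) v);
      [|now apply Hhc].
    assert (Hr : 0 < Rmin v (1 - v)) by (apply Rmin_pos; lra).
    exists (mkposreal _ Hr). intros b Hb.
    change (Rabs (b - v) < Rmin v (1 - v)) in Hb.
    assert (B1 := Rlt_le_trans _ _ _ Hb (Rmin_l _ _)).
    assert (B2 := Rlt_le_trans _ _ _ Hb (Rmin_r _ _)).
    apply Rabs_def2 in B1. apply Rabs_def2 in B2.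
    apply (RInt_correct (V := R_CompleteNormedModule)).
    apply (ex_RInt_continuous (V := R_CompleteNormedModule)).
    intros z Hz. apply Hhc. revert Hz. unfold Rmin, Rmax.
    destruct (Rle_dec (1 / 2) b); lra. }
  assert (Hmv : forall v w, 0 < v < w -> w < 1 ->
            exists z, v < z < w /\ w - v = h z * (xi w - xi v)).
  { intros v w Hv Hw.
    destruct (mean_value xi (fun v => / h v) v w) as [z [Hz E]]; [lra| | |].
    - intros x Hx. apply Hxid; lra.
    - intros x Hx. eapply is_derive_continuous, Hxid; lra.
    - exists z. split; [exact Hz|]. rewrite E. field.
      apply Rgt_not_eq, Hp; lra. }
  assert (Hxi : forall v w, 0 < v < w -> w < 1 -> xi v < xi w).
  { intros v w Hv Hw. destruct (Hmv v w Hv Hw) as [z [Hz E]].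
    assert (Hhz : 0 < h z) by (apply Hp; lra).
    assert (0 < xi w - xi v); [|lra].
    apply Rmult_lt_reg_l with (h z); lra. }
  set (S := fun x v => v = 0 \/ (0 < v < 1 /\ xi v <= x)).
  assert (Hlub : forall x, exists l, is_lub (S x) l).
  { intros x. destruct (completeness (S x)) as [l Hl].
    - exists 1. intros v [->|[Hv _]]; lra.
    - exists 0. now left.
    - now exists l. }
  set (u := fun x => real (Lub_Rbar (S x))).
  assert (Hu : forall x, is_lub (S x) (u x)).
  { intros x. destruct (Hlub x) as [l Hl]. unfold u.
    rewrite (is_lub_Rbar_unique (S x) l); [exact Hl|].
    destruct Hl as [H1 H2]. split.
    - intros v Hv. exact (H1 v Hv).
    - intros [b| |] Hb; simpl.
      + apply H2. intros v Hv. exact (Hb v Hv).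
      + exact I.
      + exact (Hb 0 (or_introl eq_refl)). }
  assert (Hrange : forall x, 0 <= u x <= 1).
  { intros x. split.
    - apply (proj1 (Hu x)). now left.
    - apply (proj2 (Hu x)). intros v [->|[Hv _]]; lra. }
  assert (Hge : forall x v, 0 < v < 1 -> xi v <= x -> v <= u x).
  { intros x v Hv Hx. apply (proj1 (Hu x)). now right. }
  assert (Hle : forall x v, 0 < v < 1 -> x <= xi v -> u x <= v).
  { intros x v Hv Hx. apply (proj2 (Hu x)). intros w [->|[Hw Hwx]]; [lra|].
    apply Rnot_lt_le. intros Hvw. assert (X := Hxi v w). lra. }
  assert (Hmono : forall x y, x <= y -> u x <= u y).
  { intros x y Hxy. apply (proj2 (Hu x)). intros w [->|[Hw Hwx]].
    - apply Hrange.
    - apply Hge; lra. }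
  assert (Hinv : forall x, 0 < u x < 1 -> xi (u x) = x).
  { intros x Hx.
    assert (Hxc := is_derive_continuous _ _ _ (Hxid (u x) Hx)).
    destruct (Rtotal_order (xi (u x)) x) as [H|[H|H]]; [exfalso|exact H|exfalso].
    - destruct (proj1 (continuous_epsP _ _) Hxc (x - xi (u x))) as [d [Hd HH]];
        [lra|].
      set (r := Rmin (d / 2) ((1 - u x) / 2)).
      assert (Hr : 0 < r) by (apply Rmin_pos; lra).
      assert (Hr1 : r <= d / 2) by apply Rmin_l.
      assert (Hr2 : r <= (1 - u x) / 2) by apply Rmin_r.
      specialize (HH (u x + r)).
      assert (X : Rabs (xi (u x + r) - xi (u x)) < x - xi (u x))
        by (apply HH; apply Rabs_def1; lra).
      apply Rabs_def2 in X.
      assert (u x + r <= u x); [|lra]. apply Hge; lra.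
    - destruct (proj1 (continuous_epsP _ _) Hxc (xi (u x) - x)) as [d [Hd HH]];
        [lra|].
      set (r := Rmin (d / 2) (u x / 2)).
      assert (Hr : 0 < r) by (apply Rmin_pos; lra).
      assert (Hr1 : r <= d / 2) by apply Rmin_l.
      assert (Hr2 : r <= u x / 2) by apply Rmin_r.
      specialize (HH (u x - r)).
      assert (X : Rabs (xi (u x - r) - xi (u x)) < xi (u x) - x)
        by (apply HH; apply Rabs_def1; lra).
      apply Rabs_def2 in X.
      assert (u x <= u x - r); [|lra]. apply Hle; lra. }
  assert (Hcont : forall x, continuous u x).
  { intros x. apply continuous_epsP. intros eps Heps.
    assert (Hr : exists r, 0 < r /\ forall y, y < x + r -> u y < u x + eps).
    { destruct (Rle_dec 1 (u x + eps / 2)) as [H|H].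
      - exists 1. split; [lra|]. intros y _. specialize (Hrange y). lra.
      - set (v := u x + eps / 2). assert (Hv : 0 < v < 1).
        { unfold v. specialize (Hrange x). lra. }
        assert (x < xi v).
        { apply Rnot_le_lt. intros Hx. specialize (Hge x v Hv Hx). unfold v in Hge.
          lra. }
        exists (xi v - x). split; [lra|]. intros y Hy.
        assert (A := Hle y v Hv). unfold v in *. lra. }
    assert (Hl : exists r, 0 < r /\ forall y, x - r < y -> u x - eps < u y).
    { destruct (Rle_dec (u x - eps / 2) 0) as [H|H].
      - exists 1. split; [lra|]. intros y _. specialize (Hrange y). lra.
      - set (v := u x - eps / 2). assert (Hv : 0 < v < 1).
        { unfold v. specialize (Hrange x). lra. }
        assert (xi v < x).
        { apply Rnot_le_lt. intros Hx. specialize (Hle x v Hv Hx). unfold v in Hle.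
          lra. }
        exists (x - xi v). split; [lra|]. intros y Hy.
        assert (A := Hge y v Hv). unfold v in *. lra. }
    destruct Hr as [r1 [Hr1 H1]]. destruct Hl as [r2 [Hr2 H2]].
    exists (Rmin r1 r2). split; [now apply Rmin_pos|]. intros y Hy.
    assert (B1 := Rlt_le_trans _ _ _ Hy (Rmin_l _ _)).
    assert (B2 := Rlt_le_trans _ _ _ Hy (Rmin_r _ _)).
    apply Rabs_def2 in B1. apply Rabs_def2 in B2.
    specialize (H1 y ltac:(lra)). specialize (H2 y ltac:(lra)).
    apply Rabs_def1; lra. }
  exists u. split; [exact Hrange|]. split; [exact Hmono|]. split; [exact Hcont|].
  split; [|split].
  - apply is_lim_spec. intros eps.
    assert (He := cond_pos eps).
    set (v := Rmin (eps / 2) (1 / 2)).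
    assert (Hv : 0 < v) by (apply Rmin_pos; lra).
    assert (Hv1 : v <= eps / 2) by apply Rmin_l.
    assert (Hv2 : v <= 1 / 2) by apply Rmin_r.
    exists (xi v). intros x Hx.
    assert (A := Hle x v ltac:(lra) ltac:(lra)). assert (B := Hrange x).
    rewrite Rminus_0_r, Rabs_pos_eq; lra.
  - apply is_lim_spec. intros eps.
    assert (He := cond_pos eps).
    set (v := Rmin (eps / 2) (1 / 2)).
    assert (Hv : 0 < v) by (apply Rmin_pos; lra).
    assert (Hv1 : v <= eps / 2) by apply Rmin_l.
    assert (Hv2 : v <= 1 / 2) by apply Rmin_r.
    exists (xi (1 - v)). intros x Hx.
    assert (A := Hge x (1 - v) ltac:(lra) ltac:(lra)). assert (B := Hrange x).
    apply Rabs_def1; lra.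
  - (* the increments of u are h z times those of x, with z close to u x *)
    intros x Hx. apply is_derive_Reals. intros eps Heps.
    destruct (proj1 (continuous_epsP h (u x)) (Hc (u x) Hx) eps Heps)
      as [rho [Hrho Hh]].
    destruct (proj1 (continuous_epsP u x) (Hcont x)
      (Rmin rho (Rmin (u x) (1 - u x)))) as [r [Hr Hur]].
    { repeat apply Rmin_pos; lra. }
    exists (mkposreal r Hr). simpl. intros t Ht0 Ht.
    specialize (Hur (x + t)).
    replace (x + t - x) with t in Hur by ring. specialize (Hur Ht).
    assert (B1 := Rlt_le_trans _ _ _ Hur (Rmin_l _ _)).
    assert (B := Rlt_le_trans _ _ _ Hur (Rmin_r _ _)).
    assert (B2 := Rlt_le_trans _ _ _ B (Rmin_l _ _)).
    assert (B3 := Rlt_le_trans _ _ _ B (Rmin_r _ _)).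
    apply Rabs_def2 in B1. apply Rabs_def2 in B2. apply Rabs_def2 in B3.
    assert (Hxt : 0 < u (x + t) < 1) by lra.
    assert (E1 := Hinv x Hx). assert (E2 := Hinv (x + t) Hxt).
    assert (Hz : exists z, Rabs (z - u x) < rho /\ u (x + t) - u x = h z * t).
    { destruct (Rtotal_order (u x) (u (x + t))) as [H|[H|H]].
      - destruct (Hmv (u x) (u (x + t))) as [z [Hz E]]; try lra.
        exists z. split; [apply Rabs_def1; lra|]. rewrite E, E1, E2. ring.
      - exfalso. apply Ht0. rewrite H in E1. lra.
      - destruct (Hmv (u (x + t)) (u x)) as [z [Hz E]]; try lra.
        exists z. split; [apply Rabs_def1; lra|].
        rewrite E1, E2 in E. lra. }
    destruct Hz as [z [Hz E]]. rewrite E.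
    replace (h z * t / t) with (h z) by (field; exact Ht0). now apply Hh.
Qed.

(** * Crossing the free boundary *)

(** On the maximal interval on which [u] is strictly between [u x] and [u y] the chain
    rule is available, and outside of it [u] does not move. *)
Lemma monotone_chain_mean_value (u V g : R -> R) (x y : R) :
  x <= y ->
  (forall t, 0 <= u t <= 1) -> (forall s t, s <= t -> u s <= u t) ->
  (forall t, continuous u t) ->
  (forall v, 0 <= v <= 1 -> continuous V v) ->
  (forall t, 0 < u t < 1 -> is_derive (fun s => V (u s)) t (g (u t))) ->
  exists z, x <= z <= y /\ Rabs (V (u y) - V (u x)) <= Rabs (g (u z)) * (y - x).
Proof.
  intros Hxy Hr Hm Hc HV Hd.
  destruct (Rle_lt_or_eq_dec (u x) (u y) (Hm x y Hxy)) as [Hlt|Heq].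
  2: { exists x. split; [lra|]. rewrite Heq, Rminus_diag, Rabs_R0.
       apply Rmult_le_pos; [apply Rabs_pos|lra]. }
  destruct (last_nonpos (fun t => u t - u x) x y) as [x' [Hx' [Hux' Hx'p]]].
  - exact Hxy.
  - intros t _. apply (continuous_minus (V := R_NormedModule));
      [apply Hc|apply continuous_const].
  - lra.
  - lra.
  - destruct (first_nonneg (fun t => u t - u y) x' y) as [y' [Hy' [Huy' Hy'n]]].
    + lra.
    + intros t _. apply (continuous_minus (V := R_NormedModule));
        [apply Hc|apply continuous_const].
    + lra.
    + lra.
    + assert (E1 : u x' = u x) by (assert (A := Hm x x'); lra).
      assert (E2 : u y' = u y) by (assert (A := Hm y' y); lra).
      destruct (mean_value (fun t => V (u t)) (fun t => g (u t)) x' y')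
        as [z [Hz E]].
      * lra.
      * intros t Ht. apply Hd.
        assert (A := Hx'p t). assert (B := Hy'n t).
        assert (C := Hr x). assert (D := Hr y). lra.
      * intros t Ht. apply (continuous_comp u V); [apply Hc|apply HV, Hr].
      * exists z. split; [lra|]. rewrite E1, E2 in E. rewrite E, Rabs_mult.
        apply Rmult_le_compat_l; [apply Rabs_pos|]. rewrite Rabs_pos_eq; lra.
Qed.

(** At a free boundary point the right-hand side [g (u x)] vanishes continuously, so
    the mean value estimate forces the derivative to exist and to be zero. *)
Lemma derive_across_free_boundary (u V g : R -> R) :
  (forall t, 0 <= u t <= 1) -> (forall s t, s <= t -> u s <= u t) ->
  (forall t, continuous u t) ->
  (forall v, 0 <= v <= 1 -> continuous V v) ->
  (forall t, continuous (fun s => g (u s)) t) -> g 0 = 0 -> g 1 = 0 ->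
  (forall t, 0 < u t < 1 -> is_derive (fun s => V (u s)) t (g (u t))) ->
  forall x, is_derive (fun s => V (u s)) x (g (u x)).
Proof.
  intros Hr Hm Hc HV Hg Hg0 Hg1 Hd x.
  assert (Hcase : 0 < u x < 1 \/ g (u x) = 0).
  { assert (A := Hr x).
    destruct (Rle_lt_or_eq_dec 0 (u x)) as [H0|H0]; [lra| |].
    - destruct (Rle_lt_or_eq_dec (u x) 1) as [H1|H1]; [lra|left; lra|].
      right. now rewrite H1.
    - right. now rewrite <- H0. }
  destruct Hcase as [Hx|Hx]; [now apply Hd|].
  rewrite Hx. apply is_derive_Reals. intros eps Heps.
  destruct (proj1 (continuous_epsP _ x) (Hg x) (eps / 2)) as [r [Hr0 H]]; [lra|].
  cbv beta in H. rewrite Hx in H.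
  exists (mkposreal r Hr0). simpl. intros t Ht0 Ht.
  assert (HB : Rabs (V (u (x + t)) - V (u x)) <= eps / 2 * Rabs t).
  { destruct (Rle_dec 0 t) as [Hpos|Hneg].
    - destruct (monotone_chain_mean_value u V g x (x + t)) as [z [Hz E]];
        auto; [lra|].
      eapply Rle_trans; [exact E|].
      replace (x + t - x) with t by ring. rewrite (Rabs_pos_eq t) by lra.
      apply Rmult_le_compat_r; [lra|].
      specialize (H z). rewrite Rminus_0_r in H. left. apply H.
      apply Rabs_def2 in Ht. apply Rabs_def1; lra.
    - destruct (monotone_chain_mean_value u V g (x + t) x) as [z [Hz E]];
        auto; [lra|].
      rewrite Rabs_minus_sym. eapply Rle_trans; [exact E|].
      rewrite (Rabs_left t) by lra.
      replace (x - (x + t)) with (- t) by ring.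
      apply Rmult_le_compat_r; [lra|].
      specialize (H z). rewrite Rminus_0_r in H. left. apply H.
      apply Rabs_def2 in Ht. apply Rabs_def1; lra. }
  rewrite Rminus_0_r. unfold Rdiv. rewrite Rabs_mult, Rabs_inv.
  assert (0 < Rabs t) by now apply Rabs_pos_lt.
  apply Rle_lt_trans with (eps / 2 * Rabs t * / Rabs t).
  - apply Rmult_le_compat_r; [|exact HB]. left. now apply Rinv_0_lt_compat.
  - field_simplify; lra.
Qed.

(** * The reaction term *)

(** [f] is controlled on [0,1] only; composing with the projection onto [0,1] gives
    functions that are continuous on the whole line. *)
Definition clip (x : R) : R := Rmax (Rmin x 1) 0.

Lemma clip_unit (x : R) : 0 <= clip x <= 1.
Proof.
  unfold clip. split; [apply Rmax_r|]. apply Rmax_lub; [apply Rmin_r|lra].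
Qed.

Lemma clip_id (x : R) : 0 <= x <= 1 -> clip x = x.
Proof. intros H. unfold clip. rewrite Rmin_left, Rmax_left; lra. Qed.

Lemma clip_lipschitz (x y : R) : Rabs (clip x - clip y) <= 1 * Rabs (x - y).
Proof.
  unfold clip. eapply Rle_trans; [apply Rmax_lipschitz|].
  rewrite Rmult_1_l. apply Rmin_lipschitz.
Qed.

Lemma clip_continuous (x : R) : continuous clip x.
Proof. apply (lipschitz_continuous _ 1); [lra|]. apply clip_lipschitz. Qed.

Lemma C1_unit_continuous_clip (f : R -> R) :
  C1_unit f -> forall x, continuous (fun t => f (clip t)) x.
Proof.
  intros [df Hdf] x.
  destruct (Hdf (clip x) (clip_unit x)) as [HD _].
  apply cont_deriv in HD.
  apply continuous_epsP. intros eps Heps.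
  destruct (HD eps Heps) as [al [Hal H]]. simpl in H. unfold R_dist in H.
  exists al. split; [exact Hal|]. intros y Hy.
  destruct (Req_dec (clip x) (clip y)) as [E|E].
  - rewrite E, Rminus_diag, Rabs_R0. exact Heps.
  - apply H. split; [split; [apply clip_unit|exact E]|].
    eapply Rle_lt_trans; [apply clip_lipschitz|]. lra.
Qed.

(** This makes [f u / u] bounded, hence the supremum finite, and lets the reaction
    term vanish at [0] even when [m < 1]. *)
Lemma concave_C1_linear_bound (f : R -> R) :
  C1_unit f -> concave_unit f -> f 0 = 0 ->
  exists B, 0 < B /\ forall v, 0 <= v <= 1 -> f v <= B * v.
Proof.
  intros [df Hdf] Hconc H0.
  destruct (Hdf 0) as [HD _]; [unfold unit_interval; lra|].
  destruct (HD 1) as [al [Hal H]]; [lra|]. simpl in H. unfold R_dist in H.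
  set (B := Rabs (df 0) + 1).
  assert (HB : 0 < B) by (unfold B; assert (X := Rabs_pos (df 0)); lra).
  assert (Hnear : forall v, 0 < v <= 1 -> v < al -> f v <= B * v).
  { intros v Hv Hva.
    assert (X : Rabs ((f v - f 0) / (v - 0) - df 0) < 1).
    { apply H. split; [split; [unfold unit_interval; lra|lra]|].
      rewrite Rminus_0_r, Rabs_pos_eq; lra. }
    rewrite H0, !Rminus_0_r in X. apply Rabs_def2 in X.
    assert (Y := Rle_abs (df 0)).
    apply Rmult_le_reg_r with (/ v); [apply Rinv_0_lt_compat; lra|].
    replace (B * v * / v) with B by (field; lra).
    unfold B. unfold Rdiv in X. lra. }
  exists B. split; [exact HB|]. intros v Hv.
  destruct (Req_dec v 0) as [->|Hv0]; [rewrite H0; lra|].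
  set (r := Rmin (al / 2) v).
  assert (Hr : 0 < r) by (apply Rmin_pos; lra).
  assert (Hr1 : r <= al / 2) by apply Rmin_l.
  assert (Hr2 : r <= v) by apply Rmin_r.
  assert (Hfr := Hnear r ltac:(lra) ltac:(lra)).
  assert (Ht : 0 < r / v) by (apply Rdiv_lt_0_compat; lra).
  (* the chord of a concave function from 0 to v lies below the graph at r *)
  assert (X : r / v * f v + (1 - r / v) * f 0 <= f (r / v * v + (1 - r / v) * 0)).
  { apply Hconc; unfold unit_interval; try lra. split; [lra|].
    apply Rmult_le_reg_r with v; [lra|]. field_simplify; lra. }
  replace (r / v * v + (1 - r / v) * 0) with r in X by (field; lra).
  rewrite H0, Rmult_0_r, Rplus_0_r in X.
  apply Rmult_le_reg_l with (r / v); [exact Ht|].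
  replace (r / v * (B * v)) with (B * r) by (field; lra). lra.
Qed.

(** The numerator [K] of the phase-plane equation [dP/du = c - K / Q]. *)
Definition reaction (m : R) (f : R -> R) (v : R) : R :=
  m * rpow (clip v) (m - 1) * f (clip v).

Lemma reaction_bounds (m B : R) (f : R -> R) (v : R) :
  0 < m -> (forall w, 0 <= w <= 1 -> 0 <= f w <= B * w) ->
  0 <= reaction m f v <= m * B * rpow (clip v) m.
Proof.
  intros Hm Hf. unfold reaction.
  destruct (Hf (clip v) (clip_unit v)) as [F1 F2].
  assert (Hr := rpow_nonneg (clip v) (m - 1)).
  split.
  - apply Rmult_le_pos; [|exact F1]. apply Rmult_le_pos; lra.
  - rewrite !Rmult_assoc. apply Rmult_le_compat_l; [lra|].
    destruct (Rlt_dec 0 (clip v)) as [Hp|Hp].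
    + rewrite !rpow_pos by exact Hp.
      replace (Rpower (clip v) m) with (Rpower (clip v) (m - 1) * clip v).
      * assert (X := Rpower_pos (clip v) (m - 1)). nra.
      * rewrite <- (Rpower_1 (clip v)) at 2 by exact Hp.
        rewrite <- Rpower_plus. f_equal; ring.
    + rewrite !rpow_nonpos by lra. lra.
Qed.

Lemma reaction_continuous (m B : R) (f : R -> R) (x : R) :
  0 < m -> (forall w, 0 <= w <= 1 -> 0 <= f w <= B * w) ->
  (forall t, continuous (fun s => f (clip s)) t) ->
  continuous (reaction m f) x.
Proof.
  intros Hm Hf Hc. destruct (Rlt_dec 0 (clip x)) as [Hp|Hp].
  - apply (continuous_mult (K := R_AbsRing) (fun v => m * rpow (clip v) (m - 1))
             (fun v => f (clip v))); [|apply Hc].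
    apply (continuous_scal_r (V := R_NormedModule) m
             (fun v => rpow (clip v) (m - 1))).
    apply (continuous_comp clip (fun w => rpow w (m - 1)));
      [apply clip_continuous|now apply rpow_continuous_pos].
  - (* at 0 the factor u^(m-1) may blow up, but the reaction is O(u^m) *)
    assert (HG : continuous (fun v => m * B * rpow (clip v) m) x).
    { apply (continuous_scal_r (V := R_NormedModule) (m * B)
               (fun v => rpow (clip v) m)).
      apply (continuous_comp clip (fun w => rpow w m));
        [apply clip_continuous|now apply rpow_continuous]. }
    assert (Hx := reaction_bounds m B f x Hm Hf).
    rewrite (rpow_nonpos (clip x)) in Hx by lra.
    apply continuous_epsP. intros eps Heps.
    destruct (proj1 (continuous_epsP _ x) HG eps Heps) as [d [Hd H]].
    exists d. split; [exact Hd|]. intros y Hy. specialize (H y Hy).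
    cbv beta in H. rewrite (rpow_nonpos (clip x)) in H by lra.
    rewrite Rmult_0_r, Rminus_0_r in H.
    assert (Hyb := reaction_bounds m B f y Hm Hf).
    replace (reaction m f x) with 0 by lra.
    rewrite Rminus_0_r, Rabs_pos_eq by lra.
    assert (X := Rle_abs (m * B * rpow (clip y) m)). lra.
Qed.

(** * From the phase plane to the wave *)

Lemma Rpower_opp_cancel (x a : R) : Rpower x a * Rpower x (- a) = 1.
Proof.
  rewrite <- Rpower_plus, Rplus_opp_r. unfold Rpower. now rewrite Rmult_0_l, exp_0.
Qed.

Lemma Rpower_one (a : R) : Rpower 1 a = 1.
Proof. unfold Rpower. now rewrite ln_1, Rmult_0_r, exp_0. Qed.

(** The two quantities differentiated across the free boundary are [u^m], with derivative
    [Q], and [P - c u], with derivative [- f]. *)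
Lemma travelling_wave_of_phase_plane (m p c : R) (f E : R -> R) :
  0 < m -> 1 < p -> 0 < c ->
  (forall t, continuous (fun s => f (clip s)) t) -> f 0 = 0 -> f 1 = 0 ->
  (forall v, continuous E v) -> E 0 = 0 -> E 1 = 0 ->
  (forall v, 0 < v < 1 -> 0 < E v) ->
  (forall v, 0 < v < 1 -> is_derive E v
     (p / (p - 1) * (c * Rpower (E v) (1 / p) - reaction m f v))) ->
  exists u, travelling_wave m p f c u.
Proof.
  intros Hm Hp Hc Hfc Hf0 Hf1 HEc HE0 HE1 HEp HEd.
  assert (Hip : 0 < 1 / p) by (apply Rdiv_lt_0_compat; lra).
  assert (Hpp : 0 < (p - 1) / p) by (apply Rdiv_lt_0_compat; lra).
  set (Q := fun v => rpow (E v) (1 / p)).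
  set (P := fun v => rpow (E v) ((p - 1) / p)).
  assert (HQc : forall v, continuous Q v).
  { intros v. apply (continuous_comp E (fun t => rpow t (1 / p)));
      [apply HEc|now apply rpow_continuous]. }
  assert (HPc : forall v, continuous P v).
  { intros v. apply (continuous_comp E (fun t => rpow t ((p - 1) / p)));
      [apply HEc|now apply rpow_continuous]. }
  assert (HQ0 : Q 0 = 0) by (unfold Q; rewrite HE0, rpow_nonpos; lra).
  assert (HQ1 : Q 1 = 0) by (unfold Q; rewrite HE1, rpow_nonpos; lra).
  assert (HQp : forall v, 0 < v < 1 -> 0 < Q v).
  { intros v Hv. unfold Q. rewrite rpow_pos by now apply HEp. apply Rpower_pos. }
  set (h := fun v => Q v * (Rpower v (1 - m) * / m)).
  assert (Hhp : forall v, 0 < v < 1 -> 0 < h v).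
  { intros v Hv. apply Rmult_lt_0_compat; [now apply HQp|].
    apply Rmult_lt_0_compat; [apply Rpower_pos|now apply Rinv_0_lt_compat]. }
  destruct (heteroclinic h) as [u [Hr [Hmon [Huc [Hl0 [Hl1 Hud]]]]]].
  { intros v Hv. apply (continuous_mult (K := R_AbsRing) Q); [apply HQc|].
    apply (continuous_mult (K := R_AbsRing) (fun v => Rpower v (1 - m)));
      [|apply continuous_const].
    eapply is_derive_continuous, Rpower_is_derive. lra. }
  { exact Hhp. }
  assert (Hum : forall x, is_derive (fun y => rpow (u y) m) x (Q (u x))).
  { apply (derive_across_free_boundary u (fun v => rpow v m) Q); auto.
    - intros v _. now apply rpow_continuous.
    - intros t. apply (continuous_comp u Q); auto.
    - intros t Ht.
      replace (Q (u t)) with (scal (h (u t)) (m * Rpower (u t) (m - 1))).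
      + apply (is_derive_comp (V := R_NormedModule) (fun v => rpow v m) u).
        * apply rpow_is_derive; lra.
        * now apply Hud.
      + unfold scal; simpl; unfold mult; simpl. unfold h.
        assert (X := Rpower_opp_cancel (u t) (m - 1)).
        replace (- (m - 1)) with (1 - m) in X by ring.
        replace (Q (u t) * (Rpower (u t) (1 - m) * / m) * (m * Rpower (u t) (m - 1)))
          with (Q (u t) * (Rpower (u t) (m - 1) * Rpower (u t) (1 - m)))
          by (field; lra).
        rewrite X. ring. }
  assert (Hflux : forall x, flux m p u x = P (u x)).
  { intros x. unfold flux. cbv zeta.
    assert (X0 : Derive (fun y => rpow (u y) m) x = Q (u x))
      by apply is_derive_unique, Hum.
    rewrite X0.
    unfold Q, P. destruct (Rlt_dec 0 (E (u x))) as [HE|HE].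
    - rewrite !(rpow_pos (E (u x))) by exact HE.
      assert (X := Rpower_pos (E (u x)) (1 / p)).
      rewrite Rabs_pos_eq by lra. rewrite rpow_pos by exact X.
      rewrite Rpower_mult, <- Rpower_plus. f_equal. field. lra.
    - rewrite !(rpow_nonpos (E (u x))) by lra. ring. }
  (* the equation along the orbit, by the chain rule *)
  assert (HPu : forall x, 0 < u x < 1 ->
     is_derive (fun y => P (u y)) x (c * h (u x) - f (u x))).
  { intros x Hx.
    replace (c * h (u x) - f (u x)) with
      (scal (h (u x)) (scal (p / (p - 1) * (c * Rpower (E (u x)) (1 / p)
          - reaction m f (u x)))
        ((p - 1) / p * Rpower (E (u x)) ((p - 1) / p - 1)))).
    - apply (is_derive_comp (V := R_NormedModule) P u); [|now apply Hud].
      apply (is_derive_comp (V := R_NormedModule) (fun t => rpow t ((p - 1) / p)) E).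
      + now apply rpow_is_derive, HEp.
      + now apply HEd.
    - unfold scal; simpl; unfold mult; simpl. unfold h, reaction, Q.
      rewrite clip_id by lra. rewrite !rpow_pos by (lra || now apply HEp).
      assert (X := Rpower_opp_cancel (u x) (m - 1)).
      replace (- (m - 1)) with (1 - m) in X by ring.
      assert (Y := Rpower_opp_cancel (E (u x)) (1 / p)).
      replace ((p - 1) / p - 1) with (- (1 / p)) by (field; lra).
      set (q := Rpower (E (u x)) (1 / p)) in *.
      set (qi := Rpower (E (u x)) (- (1 / p))) in *.
      set (r := Rpower (u x) (m - 1)) in *.
      set (ri := Rpower (u x) (1 - m)) in *.
      replace (q * (ri * / m) * (p / (p - 1) * (c * q - m * r * f (u x)) *
                  ((p - 1) / p * qi)))
        with ((q * qi) * (c * (q * (ri * / m)) - (r * ri) * f (u x)))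
        by (field; lra).
      rewrite X, Y. ring. }
  assert (HV : forall x, is_derive (fun y => P (u y) - c * u y) x (- f (clip (u x)))).
  { apply (derive_across_free_boundary u (fun v => P v - c * v)
             (fun v => - f (clip v))); auto.
    - intros v _. apply (continuous_minus (V := R_NormedModule)); [apply HPc|].
      apply (continuous_scal_r (V := R_NormedModule) c (fun v => v)).
      apply continuous_id.
    - intros t. apply (continuous_opp (V := R_NormedModule)).
      apply (continuous_comp u (fun v => f (clip v))); auto.
    - rewrite clip_id; lra.
    - rewrite clip_id; lra.
    - intros t Ht. rewrite clip_id by lra.
      replace (- f (u t)) with ((c * h (u t) - f (u t)) - c * h (u t)) by ring.
      apply (is_derive_minus (V := R_NormedModule)); [now apply HPu|].
      apply (is_derive_scal u); now apply Hud. }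
  assert (HPuc : forall x, continuous (fun y => P (u y)) x).
  { intros x. apply (continuous_comp u P); auto. }
  exists u. constructor.
  - exact Hr.
  - exact Hmon.
  - exact Hl0.
  - exact Hl1.
  - intros x. eexists; apply Hum.
  - intros x. apply (continuous_ext (fun y => P (u y))); [|apply HPuc].
    intros y. symmetry. apply Hflux.
  - intros phi a b [Hab [Hsm Hsupp]].
    assert (Hphi : forall x, is_derive phi x (Derive phi x)).
    { intros x. apply Derive_correct. exact (Hsm 1%nat x). }
    assert (Hphic : forall x, continuous (Derive phi) x).
    { intros x. apply (ex_derive_continuous (K := R_AbsRing) (V := R_NormedModule)).
      exact (Hsm 2%nat x). }
    assert (HI : is_RInt (fun x => - f (clip (u x)) * phi x
                   + (P (u x) - c * u x) * Derive phi x) a b 0).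
    { replace 0 with (minus ((P (u b) - c * u b) * phi b)
                            ((P (u a) - c * u a) * phi a)).
      2: { rewrite !Hsupp by lra. unfold minus, plus, opp; simpl. ring. }
      apply (is_RInt_derive (V := R_CompleteNormedModule)
               (fun x => (P (u x) - c * u x) * phi x)).
      - intros x _.
        apply (is_derive_mult (fun x => P (u x) - c * u x) phi); [apply HV|apply Hphi|].
        intros; apply Rmult_comm.
      - intros x _. apply (continuous_plus (V := R_NormedModule)).
        + apply (continuous_mult (K := R_AbsRing)).
          * apply (continuous_opp (V := R_NormedModule)).
            apply (continuous_comp u (fun v => f (clip v))); auto.
          * eapply is_derive_continuous, Hphi.
        + apply (continuous_mult (K := R_AbsRing)); [|apply Hphic].
          eapply is_derive_continuous, HV. }
    assert (HI2 : is_RInt (fun x => f (clip (u x)) * phi x) a b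
                    (RInt (fun x => f (clip (u x)) * phi x) a b)).
    { apply (RInt_correct (V := R_CompleteNormedModule)).
      apply (ex_RInt_continuous (V := R_CompleteNormedModule)). intros x _.
      apply (continuous_mult (K := R_AbsRing)).
      - apply (continuous_comp u (fun v => f (clip v))); auto.
      - eapply is_derive_continuous, Hphi. }
    rewrite (RInt_ext (fun x => f (u x) * phi x) (fun x => f (clip (u x)) * phi x)).
    2: { intros x _. now rewrite clip_id by apply Hr. }
    apply is_RInt_unique.
    assert (HS := is_RInt_plus (V := R_NormedModule) _ _ _ _ _ _ HI HI2).
    change (plus 0 ?r) with (0 + r) in HS. rewrite Rplus_0_l in HS.
    refine (is_RInt_ext _ _ _ _ _ _ HS). intros x _.
    rewrite Hflux. unfold plus; simpl. ring.
  - intros x Hx. split.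
    + eexists; now apply Hud.
    + rewrite (is_derive_unique _ _ _ (Hud x Hx)). now apply Hhp.
  - intros x Hx w.
    set (mu := Rpower (/ m) (p - 1)).
    assert (Hmu : Rpower m (p - 1) * mu = 1).
    { unfold mu. rewrite Rpower_mult_distr by (auto using Rinv_0_lt_compat).
      rewrite Rinv_r by lra. apply Rpower_one. }
    assert (Hw : forall y, 0 < u y < 1 -> w y = mu * P (u y)).
    { intros y Hy. unfold w. rewrite (is_derive_unique _ _ _ (Hud y Hy)).
      rewrite <- Rpower_mult.
      rewrite Rpower_mult_distr by (auto using Rpower_pos).
      replace (Rpower (u y) (m - 1) * h (u y)) with (/ m * Q (u y)).
      - rewrite <- Rpower_mult_distr by (auto using Rinv_0_lt_compat).
        fold mu. f_equal. unfold Q, P. rewrite !rpow_pos by now apply HEp.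
        rewrite Rpower_mult. f_equal. field; lra.
      - unfold h. assert (X := Rpower_opp_cancel (u y) (m - 1)).
        replace (- (m - 1)) with (1 - m) in X by ring.
        replace (Rpower (u y) (m - 1) * (Q (u y) * (Rpower (u y) (1 - m) * / m)))
          with ((Rpower (u y) (m - 1) * Rpower (u y) (1 - m)) * (/ m * Q (u y)))
          by ring.
        rewrite X. ring. }
    assert (Hdw : is_derive w x (mu * (c * h (u x) - f (u x)))).
    { apply (is_derive_ext_loc (fun y => mu * P (u y))).
      - destruct (proj1 (continuous_epsP u x) (Huc x) (Rmin (u x) (1 - u x)))
          as [d [Hd H]]; [apply Rmin_pos; lra|].
        exists (mkposreal d Hd). intros y Hy. specialize (H y Hy).
        assert (B1 := Rlt_le_trans _ _ _ H (Rmin_l _ _)).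
        assert (B2 := Rlt_le_trans _ _ _ H (Rmin_r _ _)).
        apply Rabs_def2 in B1. apply Rabs_def2 in B2.
        symmetry. apply Hw. lra.
      - apply (is_derive_scal (fun y => P (u y))); now apply HPu. }
    split; [eexists; exact Hdw|].
    rewrite (is_derive_unique _ _ _ Hdw), (is_derive_unique _ _ _ (Hud x Hx)).
    rewrite <- Rmult_assoc, Hmu. ring.
Qed.

(** * The bound *)

(** The real part of an infinite supremum is a default value, whence the bound [B]. *)
Lemma Lub_Rbar_ub_bounded (A : R -> Prop) (B x : R) :
  (forall y, A y -> y <= B) -> A x -> x <= real (Lub_Rbar A).
Proof.
  intros HB Hx. destruct (Lub_Rbar_correct A) as [H1 H2].
  assert (X := H1 x Hx). assert (Y := H2 B HB).
  destruct (Lub_Rbar A) as [l| |]; simpl in *; [exact X|contradiction|contradiction].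
Qed.

(** [lam] is chosen so that [lam^(p/(p-1)) = m/(p-1) S^(1/(p-1))]; the inequality is the
    bound by [S] raised to the power [1/(p-1)] and multiplied by [m u^(1/(p-1))]. *)
Lemma reaction_le_of_sup (m p S u fu : R) :
  0 < m -> 1 < p -> 0 < u -> 0 < fu ->
  Rpower u (m * (p - 1) - 1) * Rpower (fu / u) (p - 1) <= S ->
  let lam := Rpower (m / (p - 1)) ((p - 1) / p) * Rpower S (1 / p) in
  m * Rpower u (m - 1) * fu <= (p * lam - lam) * Rpower (lam * u) (1 / (p - 1)).
Proof.
  intros Hm Hp Hu Hfu HS lam.
  assert (Hfu' : 0 < fu / u) by now apply Rdiv_lt_0_compat.
  assert (Hmp : 0 < m / (p - 1)) by (apply Rdiv_lt_0_compat; lra).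
  set (G := Rpower u (m * (p - 1) - 1) * Rpower (fu / u) (p - 1)) in *.
  assert (HG : 0 < G) by (apply Rmult_lt_0_compat; apply Rpower_pos).
  assert (Hlam : 0 < lam) by (apply Rmult_lt_0_compat; apply Rpower_pos).
  assert (Ha : 0 < 1 / (p - 1)) by (apply Rdiv_lt_0_compat; lra).
  assert (HGS : Rpower G (1 / (p - 1)) <= Rpower S (1 / (p - 1)))
    by (apply Rle_Rpower_l; lra).
  assert (E1 : Rpower G (1 / (p - 1)) * Rpower u (1 / (p - 1)) = Rpower u (m - 1) * fu).
  { unfold G. rewrite <- Rpower_mult_distr by apply Rpower_pos.
    rewrite !Rpower_mult.
    replace ((p - 1) * (1 / (p - 1))) with 1 by (field; lra).
    rewrite (Rpower_1 (fu / u)) by exact Hfu'.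
    replace (Rpower u ((m * (p - 1) - 1) * (1 / (p - 1))) * (fu / u)
               * Rpower u (1 / (p - 1))) with
      (Rpower u ((m * (p - 1) - 1) * (1 / (p - 1))) * Rpower u (1 / (p - 1))
         * (fu / u)) by ring.
    rewrite <- Rpower_plus.
    replace ((m * (p - 1) - 1) * (1 / (p - 1)) + 1 / (p - 1)) with (m - 1 + 1)
      by (field; lra).
    rewrite Rpower_plus, Rpower_1 by exact Hu. field. lra. }
  assert (E2 : lam * Rpower lam (1 / (p - 1)) = m / (p - 1) * Rpower S (1 / (p - 1))).
  { rewrite <- (Rpower_1 lam) at 1 by exact Hlam. rewrite <- Rpower_plus.
    unfold lam. rewrite <- Rpower_mult_distr by apply Rpower_pos.
    rewrite !Rpower_mult.
    replace ((p - 1) / p * (1 + 1 / (p - 1))) with 1 by (field; lra).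
    replace (1 / p * (1 + 1 / (p - 1))) with (1 / (p - 1)) by (field; lra).
    now rewrite Rpower_1. }
  rewrite <- Rpower_mult_distr by assumption.
  replace ((p * lam - lam) * (Rpower lam (1 / (p - 1)) * Rpower u (1 / (p - 1))))
    with ((p - 1) * (lam * Rpower lam (1 / (p - 1))) * Rpower u (1 / (p - 1))) by ring.
  rewrite E2, Rmult_assoc, <- E1.
  replace ((p - 1) * (m / (p - 1) * Rpower S (1 / (p - 1))) * Rpower u (1 / (p - 1)))
    with (m * (Rpower S (1 / (p - 1)) * Rpower u (1 / (p - 1)))) by (field; lra).
  apply Rmult_le_compat_l; [lra|]. apply Rmult_le_compat_r; [|exact HGS].
  left; apply Rpower_pos.
Qed.

Theorem mainTheorem2 (m p : R) (f : R -> R) (cstar : R)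
  (hm : 0 < m) (hp : 1 < p)
  (hgamma : 0 <= m * (p - 1) - 1)
  (hfC1 : C1_unit f)
  (hf0 : f 0 = 0) (hf1 : f 1 = 0)
  (hfpos : forall u, 0 < u < 1 -> 0 < f u)
  (hfconcave : concave_unit f)
  (hcstar : is_minimal_speed m p f cstar) :
  cstar <=
    p * Rpower (m / (p - 1)) ((p - 1) / p)
      * Rpower
          (real (Lub_Rbar (fun y => exists u, 0 < u < 1 /\
             y = Rpower u (m * (p - 1) - 1) * Rpower (f u / u) (p - 1))))
          (1 / p).
Proof.
  set (S := real _).
  destruct (concave_C1_linear_bound f hfC1 hfconcave hf0) as [B [HB HfB]].
  assert (HS : forall u, 0 < u < 1 ->
    Rpower u (m * (p - 1) - 1) * Rpower (f u / u) (p - 1) <= S).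
  { intros u Hu. apply (Lub_Rbar_ub_bounded _ (1 * Rpower B (p - 1))).
    - intros y [v [Hv ->]].
      apply Rmult_le_compat; try (left; apply Rpower_pos).
      + apply Rle_trans with (Rpower 1 (m * (p - 1) - 1)).
        * apply Rle_Rpower_l; lra.
        * rewrite Rpower_one. lra.
      + apply Rle_Rpower_l; [lra|]. split.
        * apply Rdiv_lt_0_compat; [now apply hfpos|lra].
        * apply Rmult_le_reg_r with v; [lra|].
          replace (f v / v * v) with (f v) by (field; lra). apply HfB; lra.
    - now exists u. }
  set (lam := Rpower (m / (p - 1)) ((p - 1) / p) * Rpower S (1 / p)).
  assert (Hlam : 0 < lam) by (apply Rmult_lt_0_compat; apply Rpower_pos).
  replace (p * Rpower (m / (p - 1)) ((p - 1) / p) * Rpower S (1 / p))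
    with (p * lam) by (unfold lam; ring).
  assert (Hc : 0 < p * lam) by (apply Rmult_lt_0_compat; lra).
  destruct hcstar as [_ [_ Hno]].
  apply Rnot_lt_le. intros Hlt. apply (Hno (p * lam)); [lra|].
  assert (Hfc := C1_unit_continuous_clip f hfC1).
  assert (Hf : forall w, 0 <= w <= 1 -> 0 <= f w <= B * w).
  { intros w Hw. split; [|now apply HfB].
    destruct (Req_dec w 0) as [->|]; [lra|]. destruct (Req_dec w 1) as [->|]; [lra|].
    left. apply hfpos. lra. }
  assert (Hreact : forall u, 0 < u < 1 ->
            reaction m f u = m * Rpower u (m - 1) * f u).
  { intros u Hu. unfold reaction. rewrite clip_id by lra. now rewrite rpow_pos. }
  destruct (phase_plane_solution (reaction m f) p (p * lam) lam (m * B))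
    as [E [HEc [HE0 [HE1 [HEp HEd]]]]]; auto.
  - intros u. now apply reaction_continuous with B.
  - intros u. assert (X := reaction_bounds m B f u hm Hf). split; [lra|].
    assert (Y : rpow (clip u) m <= rpow 1 m) by (apply rpow_le; [lra|apply clip_unit]).
    rewrite (rpow_pos 1), Rpower_one in Y by lra.
    assert (0 < m * B) by now apply Rmult_lt_0_compat. nra.
  - intros u Hu. rewrite Hreact by exact Hu.
    apply Rmult_lt_0_compat; [|now apply hfpos].
    apply Rmult_lt_0_compat; [exact hm|apply Rpower_pos].
  - intros u Hu. rewrite Hreact by exact Hu.
    apply (reaction_le_of_sup m p S u (f u)); auto; lra.
  - now apply (travelling_wave_of_phase_plane m p (p * lam) f E).
Qed.
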